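(* For every integer $n\ge 14$, $$ex_3(n;P^3_3|C^3_3)=20+\binom{n-7}2\quad\text{and}\quad Ex_3(n;P^3_3|C^3_3)=\{K^3_6\cup S^3_{n-6}\},$$ where members of $Ex_3(n;P^3_3|C^3_3)$ are considered up to isomorphism.
   Context: A 3-graph is a pair $H=(V,E)$ with $V$ a finite set and $E\subseteq\binom V3$ (the edges); isolated vertices are allowed. A 3-graph is $F$-free if it contains no subhypergraph isomorphic to $F$ (not necessarily induced). $P^3_3$ is the linear path of length 3: the 3-graph with three edges $e_1,e_2,e_3$ such that $|e_1\cap e_2|=|e_2\cap e_3|=1$ and $e_1\cap e_3=\emptyset$ (7 vertices). $C^3_3$ is the triangle: the 3-graph on 6 vertices $a,b,c,d,e,f$ with the three edges $\{a,b,c\},\{c,d,e\},\{e,f,a\}$. $K^3_6$ is the complete 3-graph on 6 vertices (all 20 triples), and $S^3_m$ is the full star on $m$ vertices (all $\binom{m-1}2$ triples containing one fixed vertex). $F\cup H$ denotes the union of vertex-disjoint copies of $F$ and $H$. $ex_3(n;P^3_3|C^3_3)$ denotes the largest number of edges in an $n$-vertex $P^3_3$-free 3-graph that contains a copy of $C^3_3$ as a subhypergraph, and $Ex_3(n;P^3_3|C^3_3)$ is the set of all pairwise non-isomorphic $n$-vertex $P^3_3$-free 3-graphs containing a copy of $C^3_3$ and having exactly $ex_3(n;P^3_3|C^3_3)$ edges. *)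

(* Defs.v *)
From HB Require Import structures.
From mathcomp Require Import all_boot.

Set Implicit Arguments.
Unset Strict Implicit.
Unset Printing Implicit Defensive.

(* The vertex set is the whole type V, so vertices in no edge are allowed. *)
Definition uniform3 (V : finType) (E : {set {set V}}) : bool :=
  [forall e in E, #|e| == 3].

Record graph3 (V : finType) : Type := Graph3 {
  edges : {set {set V}};
  edges_uniform3 : uniform3 edges
}.

HB.instance Definition _ (V : finType) := [isSub for @edges V].
HB.instance Definition _ (V : finType) := [Choice of graph3 V by <:].
HB.instance Definition _ (V : finType) := [Countable of graph3 V by <:].
HB.instance Definition _ (V : finType) := [Finite of graph3 V by <:].

(* A not necessarily induced subhypergraph of H isomorphic to F is given by an
   injection of the vertices of F that sends edges of F to edges of H. *)
Definition contains (U V : finType) (F : graph3 U) (H : graph3 V) : bool :=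
  [exists f : {ffun U -> V},
     injectiveb f && [forall e in edges F, f @: e \in edges H]].

Lemma containsP (U V : finType) (F : graph3 U) (H : graph3 V) :
  reflect (exists2 f : U -> V, injective f &
             forall e, e \in edges F -> f @: e \in edges H)
          (contains F H).
Proof.
apply: (iffP existsP) => [[f /andP[/injectiveP injf /forall_inP fE]]|].
  by exists f.
move=> [f injf fE]; exists (finfun f); apply/andP; split.
  by apply/injectiveP => x y; rewrite !ffunE => /injf.
apply/forall_inP => e /fE.
by rewrite (eq_imset _ (ffunE f)).
Qed.

Definition free (U V : finType) (F : graph3 U) (H : graph3 V) : bool :=
  ~~ contains F H.

Definition isomorphic (U V : finType) (G : graph3 U) (H : graph3 V) : Prop :=
  exists2 f : U -> V, bijective f &
    forall e : {set U}, (f @: e \in edges H) = (e \in edges G).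

(* The maximum is 0 when no 3-graph on n vertices is F-free and contains G. *)
Definition ex3 (n : nat) (U W : finType) (F : graph3 U) (G : graph3 W) : nat :=
  \max_(H : graph3 'I_n | free F H && contains G H) #|edges H|.

(* The members of Ex_3(#|V|; F | G) with vertex set V, as labelled 3-graphs:
   isomorphic copies are not identified. *)
Definition Ex3 (V : finType) (U W : finType) (F : graph3 U) (G : graph3 W) :
    {set graph3 V} :=
  [set H : graph3 V | [&& free F H, contains G H
                        & #|edges H| == ex3 #|V| F G]].

Definition triple (n a b c : nat) : {set 'I_n} :=
  [set i : 'I_n | val i \in [:: a; b; c]].

Definition path_edges : {set {set 'I_7}} :=
  [set triple 7 0 1 2; triple 7 2 3 4; triple 7 4 5 6].

Lemma path_uniform3 : uniform3 path_edges.
Proof.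
apply/forall_inP => e; rewrite !inE => /orP[/orP[]|] /eqP->;
  by rewrite cardsE -sum1_card big_mkcond !big_ord_recl big_ord0.
Qed.

Definition P33 : graph3 'I_7 := Graph3 path_uniform3.

Definition triangle_edges : {set {set 'I_6}} :=
  [set triple 6 0 1 2; triple 6 2 3 4; triple 6 4 5 0].

Lemma triangle_uniform3 : uniform3 triangle_edges.
Proof.
apply/forall_inP => e; rewrite !inE => /orP[/orP[]|] /eqP->;
  by rewrite cardsE -sum1_card big_mkcond !big_ord_recl big_ord0.
Qed.

Definition C33 : graph3 'I_6 := Graph3 triangle_uniform3.

Definition complete_edges (m : nat) : {set {set 'I_m}} :=
  [set e : {set 'I_m} | #|e| == 3].

Lemma complete_uniform3 (m : nat) : uniform3 (complete_edges m).
Proof. by apply/forall_inP => e; rewrite inE. Qed.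

Definition K3 (m : nat) : graph3 'I_m := Graph3 (complete_uniform3 m).

(* The fixed vertex is the vertex 0 of 'I_m; there are no edges if m = 0. *)
Definition star_edges (m : nat) : {set {set 'I_m}} :=
  [set e : {set 'I_m} | (#|e| == 3) && [exists v in e, val v == 0]].

Lemma star_uniform3 (m : nat) : uniform3 (star_edges m).
Proof. by apply/forall_inP => e; rewrite inE => /andP[]. Qed.

Definition S3 (m : nat) : graph3 'I_m := Graph3 (star_uniform3 m).

Definition dunion_edges (U V : finType) (F : graph3 U) (H : graph3 V) :
    {set {set U + V}} :=
  [set [set inl x | x in e] | e : {set U} in edges F]
    :|: [set [set inr y | y in e] | e : {set V} in edges H].

Lemma dunion_uniform3 (U V : finType) (F : graph3 U) (H : graph3 V) :
  uniform3 (dunion_edges F H).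
Proof.
apply/forall_inP => e; rewrite inE => /orP[] /imsetP[e' e'E ->].
  rewrite card_imset; first exact: (forall_inP (edges_uniform3 F)).
  by move=> x y [].
rewrite card_imset; first exact: (forall_inP (edges_uniform3 H)).
by move=> x y [].
Qed.

Definition dunion (U V : finType) (F : graph3 U) (H : graph3 V) :
    graph3 (U + V)%type :=
  Graph3 (dunion_uniform3 F H).

(* Main.v *)
Require Import Defs.
From mathcomp Require Import all_boot.
From mathcomp Require Import zify.

(** Let a path-free 3-graph contain a triangle with corners [x1], [x2], [x3] and
    midpoints [y1], [y2], [y3] ([yi] on the side opposite to [xi]), and let [U]
    be the set of these six vertices. An edge that misses one side of the
    triangle and meets another one in a single vertex starts a path, so an edge
    that leaves [U] without avoiding it must meet all three sides: it is [w] together with one of the six pairs [xi xj], [xi yi]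
    ([attached_net]). Hence [U] and the set [W] of such vertices [w] carry a
    union of components, and all other edges live on the remaining [q] vertices.

    If [W] is empty, the first part has at most [C(6,3) = 20] edges. If not,
    at most 14 edges lie inside [U]: given an edge [w p p'], no triple of [U]
    separating [p] from [p'] is present together with its complement in [U]
    ([spanned_le14]). Moreover, two vertices of [W] have at most 6 edges in
    total, because [w xi xj] and [w' xk yk] are the ends of a path whose middle
    is a side of the triangle ([attachments_pair]). So the first part has at
    most 20 edges if [W] is a singleton, and [14 + 3 |W|] if [W] is larger
    ([triangle_decomposition]).

    The other part is path-free, which calls for the Turan number of the path
    ([path_free_star_or_small]): on [r >= 8] vertices, a path-free 3-graph is
    contained in a star or has fewer than [C(r-1,2)] edges. This goes by strong
    induction on [r]. With a triangle, the decomposition above and the induction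
    hypothesis suffice. Without a triangle, if there are at least [C(r-1,2)] edges,
    then on average, hence for some vertex [x], the link [L] has more than
    [r - 1] edges. Let [G] be the set of edges avoiding [x]. If a link edge [l] meets [g] in [G] without being contained in
    it, then every link edge disjoint from [l] equals [g] minus [l], since
    otherwise there is a path or a triangle ([link_rigid]). If this happens at
    all, then [L] is close to a star and [|L| + |G|] is linear in [r]
    ([crossing_small]). If it never happens, then the vertices covered by [G]
    have at most two link neighbours each, and the induction hypothesis bounds
    [G] ([noncrossing_le], [noncrossing_arith]).

    Comparing the bounds, the sum is largest exactly when [W] is empty, all 20
    triples of [U] are edges and the remaining [n - 6 >= 8] vertices carry a full
    star ([triangle_extremal]). *)

Set Implicit Arguments.
Unset Strict Implicit.
Unset Printing Implicit Defensive.

(** * Paths, triangles and explicit vertices *)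

Definition path_free (V : finType) (E : {set {set V}}) : Prop :=
  forall a b c d e f g : V, uniq [:: a; b; c; d; e; f; g] ->
    [set a; b; c] \in E -> [set c; d; e] \in E -> [set e; f; g] \in E -> False.

(** The vertex [yi] is the midpoint of the side that avoids the corner [xi]; this
    makes the relation invariant under cyclic shifts of the indices. *)
Definition triangle_in (V : finType) (E : {set {set V}})
    (x1 x2 x3 y1 y2 y3 : V) : Prop :=
  [/\ uniq [:: x1; x2; x3; y1; y2; y3],
      [set x2; y1; x3] \in E, [set x3; y2; x1] \in E & [set x1; y3; x2] \in E].

Definition spanned (V : finType) (E : {set {set V}}) (S : {set V}) :=
  [set e in E | e \subset S].

(** Equality of explicit finite sets, by cases on every equality test. *)
Ltac seteq := apply/setP => ?; rewrite !inE;
  repeat (match goal with |- context [?a == ?b] => case: (a == b) end);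
  by rewrite ?orbT ?andbT ?andbF ?orbF.

Lemma mem_notin_neq (T : finType) (A : {set T}) (x y : T) :
  x \in A -> y \notin A -> x != y.
Proof. by move=> xA; apply: contraNneq => <-. Qed.

Ltac split_ands := repeat match goal with
  | H : is_true (_ && _) |- _ => case/andP: H => ? ?
  end.

(** Disequality of two vertices, read off a hypothesis in either orientation, or
    from an edge that contains one of them and not the other. *)
Ltac neq := first [ assumption | by rewrite eq_sym
  | match goal with
    | H : is_true (?a \in ?e), K : is_true (?b \notin ?e) |- is_true (?a != ?b) =>
        exact: (mem_notin_neq H K)
    | H : is_true (?a \in ?e), K : is_true (?b \notin ?e) |- is_true (?b != ?a) =>
        rewrite eq_sym; exact: (mem_notin_neq H K)
    end ].

Ltac distinct := rewrite /= ?inE ?negb_or ?andbT;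
  repeat (apply/andP; split); solve [by [] | neq].

(** Turns a [uniq] or [\notin] hypothesis about an explicit list into the
    disequalities that [neq] looks up. *)
Ltac expand H := move: H; rewrite /= ?inE ?negb_or ?andbT; move=> H; split_ands.

Lemma uniform3_card (V : finType) (E : {set {set V}}) (e : {set V}) :
  uniform3 E -> e \in E -> #|e| = 3.
Proof. by move=> /forall_inP uE /uE/eqP. Qed.

Lemma card3_split (V : finType) (e : {set V}) (u : V) : #|e| = 3 -> u \in e ->
  exists s t, [/\ e = [set u; s; t], u != s, u != t & s != t].
Proof.
move=> e3 ue; have : #|e :\ u| == 2 by move: e3; rewrite (cardsD1 u) ue add1n => -[->].
case/cards2P => s [t] [st eD]; exists s, t.
have : (s \in e :\ u) && (t \in e :\ u) by rewrite eD !inE !eqxx orbT.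
rewrite !in_setD1 => /andP[/andP[su _] /andP[tu _]].
by split; rewrite // 1?eq_sym // -(setD1K ue) eD setUA.
Qed.

Lemma card3_eq (V : finType) (e : {set V}) (a b c : V) : #|e| = 3 ->
  a \in e -> b \in e -> c \in e -> a != b -> a != c -> b != c ->
  e = [set a; b; c].
Proof.
move=> e3 ae be ce ab ac bc; apply/eqP; rewrite eq_sym eqEcard e3.
have -> : #|[set a; b; c]| = 3.
  by rewrite setUC cardsU1 cards2 !inE negb_or ab (eq_sym c) ac eq_sym bc.
by rewrite leqnn andbT; apply/subsetP => z; rewrite !inE => /orP[/orP[]|] /eqP->.
Qed.

(** The path is [e], [a b c], [c d f], whatever the other two vertices of [e] are. *)
Lemma no_pendant (V : finType) (E : {set {set V}}) (e : {set V}) (a b c d f : V) :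
  uniform3 E -> path_free E -> e \in E -> uniq [:: a; b; c; d; f] ->
  [set a; b; c] \in E -> [set c; d; f] \in E ->
  a \in e -> b \notin e -> c \notin e -> d \notin e -> f \notin e -> False.
Proof.
move=> uE pE eE U abcE cdfE ae be ce de fe.
have [s [t [eq_e us ut st]]] := card3_split (uniform3_card uE eE) ae.
have se : s \in e by rewrite eq_e !inE eqxx orbT.
have te : t \in e by rewrite eq_e !inE eqxx !orbT.
expand U.
apply: (pE s t a b c d f) => //; first by distinct.
by have -> : [set s; t; a] = e by rewrite eq_e; seteq.
Qed.

Lemma triangle_rot (V : finType) (E : {set {set V}}) (x1 x2 x3 y1 y2 y3 : V) :
  triangle_in E x1 x2 x3 y1 y2 y3 -> triangle_in E x2 x3 x1 y2 y3 y1.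
Proof.
case=> U E1 E2 E3; expand U; split => //; by distinct.
Qed.

(** An edge [e] that avoids the side [x2 y1 x3] cannot meet either of the other
    two sides in one vertex ([no_pendant]), so it contains all or none of the three
    vertices [x1], [y2], [y3] off that side. *)
Lemma miss_side (V : finType) (E : {set {set V}}) (e : {set V})
    (x1 x2 x3 y1 y2 y3 : V) :
  uniform3 E -> path_free E -> triangle_in E x1 x2 x3 y1 y2 y3 -> e \in E ->
  [|| x2 \in e, y1 \in e, x3 \in e |
      ((y2 \in e) == (x1 \in e)) && ((x1 \in e) == (y3 \in e))].
Proof.
move=> uE pE [U E1 E2 E3] eE; expand U.
case x2e: (x2 \in e) => //; case y1e: (y1 \in e) => //.
case x3e: (x3 \in e) => //=; move/negbT in x2e; move/negbT in y1e; move/negbT in x3e.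
have E1' : [set x3; y1; x2] \in E by have -> : [set x3; y1; x2] = [set x2; y1; x3] by seteq.
have E2' : [set y2; x1; x3] \in E by have -> : [set y2; x1; x3] = [set x3; y2; x1] by seteq.
have E2'' : [set x1; y2; x3] \in E by have -> : [set x1; y2; x3] = [set x3; y2; x1] by seteq.
have E3' : [set y3; x1; x2] \in E by have -> : [set y3; x1; x2] = [set x1; y3; x2] by seteq.
case y2e: (y2 \in e); case x1e: (x1 \in e) => /=.
- case y3e: (y3 \in e) => //; move/negbT in y3e; exfalso.
  by apply: (@no_pendant _ E e x1 y3 x2 y1 x3) => //; distinct.
- move/negbT in x1e; exfalso.
  by apply: (@no_pendant _ E e y2 x1 x3 y1 x2) => //; distinct.
- move/negbT in y2e; exfalso.
  by apply: (@no_pendant _ E e x1 y2 x3 y1 x2) => //; distinct.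
case y3e: (y3 \in e) => //; move/negbT in x1e; exfalso.
by apply: (@no_pendant _ E e y3 x1 x2 y1 x3) => //; distinct.
Qed.

(** * Edges attached to a triangle *)

Definition core (V : finType) (x1 x2 x3 y1 y2 y3 : V) : {set V} :=
  [set z in [:: x1; x2; x3; y1; y2; y3]].

(** The pairs that meet all three sides. The [i]-th and the [(i+3)]-rd pair are
    disjoint; this pairing is what [attachments_pair] uses. *)
Definition net (V : finType) (x1 x2 x3 y1 y2 y3 : V) : seq {set V} :=
  [:: [set x2; x3]; [set x3; x1]; [set x1; x2];
      [set x1; y1]; [set x2; y2]; [set x3; y3]].

Lemma count_mem_card (T : finType) (A : {set T}) (s : seq T) :
  uniq s -> count (mem A) s <= #|A|.
Proof.
move=> us; rewrite -size_filter -(card_uniqP (filter_uniq _ us)).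
by apply/subset_leq_card/subsetP => z; rewrite mem_filter => /andP[].
Qed.

(** By [miss_side], if [e] avoided a side, it would contain the three vertices
    off this side and be included in the core. So [e] meets every side, in at
    most two vertices because of [w]. The proof enumerates the membership
    patterns that survive. *)
Lemma attached_net (V : finType) (E : {set {set V}}) (e : {set V})
    (x1 x2 x3 y1 y2 y3 w : V) :
  uniform3 E -> path_free E -> triangle_in E x1 x2 x3 y1 y2 y3 -> e \in E ->
  w \in e -> w \notin core x1 x2 x3 y1 y2 y3 ->
  ~~ [disjoint e & core x1 x2 x3 y1 y2 y3] ->
  exists2 p, p \in net x1 x2 x3 y1 y2 y3 & e = w |: p.
Proof.
move=> uE pE tE eE we wU meet.
have e3 := uniform3_card uE eE.
have F1 := miss_side uE pE tE eE.
have F2 := miss_side uE pE (triangle_rot tE) eE.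
have F3 := miss_side uE pE (triangle_rot (triangle_rot tE)) eE.
have [U _ _ _] := tE.
(* The vertex [w] takes one of the three places in [e]. *)
have le2 : count (mem e) [:: x1; x2; x3; y1; y2; y3] <= 2.
  have := @count_mem_card _ e (w :: [:: x1; x2; x3; y1; y2; y3]).
  rewrite cons_uniq U andbT; move: wU; rewrite inE => -> /(_ isT).
  by rewrite e3 /= we.
have some : has (mem e) [:: x1; x2; x3; y1; y2; y3].
  case/pred0Pn: meet => z /andP[ze zU]; apply/hasP.
  exists z; last exact: ze.
  by have : z \in core x1 x2 x3 y1 y2 y3 := zU; rewrite inE.
have pairE a b : a \in e -> b \in e -> w != a -> w != b -> a != b ->
    e = w |: [set a; b].
  by move=> ae be wa wb ab; rewrite (card3_eq e3 we ae be) // setUA.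
move: wU; rewrite inE; move=> wU; expand wU; expand U.
have net_pair a b : [set a; b] \in net x1 x2 x3 y1 y2 y3 ->
    a \in e -> b \in e -> w != a -> w != b -> a != b ->
    exists2 p, p \in net x1 x2 x3 y1 y2 y3 & e = w |: p.
  by move=> abN ae be wa wb ab; exists [set a; b] => //; exact: pairE.
move: F1 F2 F3 le2 some.
case b1: (x1 \in e); case b2: (x2 \in e); case b3: (x3 \in e);
case c1: (y1 \in e); case c2: (y2 \in e); case c3: (y3 \in e);
rewrite /= ?b1 ?b2 ?b3 ?c1 ?c2 ?c3 //= => _ _ _ _ _.
- by apply: (net_pair x1 x2); rewrite // !inE eqxx ?orbT.
- by apply: (net_pair x3 x1); rewrite // ?inE ?eqxx ?orbT // eq_sym.
- by apply: (net_pair x1 y1); rewrite // !inE eqxx ?orbT.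
- by apply: (net_pair x2 x3); rewrite // !inE eqxx ?orbT.
- by apply: (net_pair x2 y2); rewrite // !inE eqxx ?orbT.
- by apply: (net_pair x3 y3); rewrite // !inE eqxx ?orbT.
Qed.

(** An edge [e'] through [w] avoiding the core would be continued by [e] and then
    by a side that meets [e] in one corner. *)
Lemma attached_closed (V : finType) (E : {set {set V}}) (e e' : {set V})
    (x1 x2 x3 y1 y2 y3 w : V) :
  uniform3 E -> path_free E -> triangle_in E x1 x2 x3 y1 y2 y3 ->
  e \in E -> e' \in E -> w \in e -> w \in e' ->
  w \notin core x1 x2 x3 y1 y2 y3 ->
  ~~ [disjoint e & core x1 x2 x3 y1 y2 y3] ->
  ~~ [disjoint e' & core x1 x2 x3 y1 y2 y3].
Proof.
move=> uE pE tE eE e'E we we' wU meet; apply/negP => dis.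
have [p pN eq_e] := attached_net uE pE tE eE we wU meet.
have out z : z \in core x1 x2 x3 y1 y2 y3 -> z \notin e'.
  by move=> zU; rewrite (disjointFl dis zU).
have [U E1 E2 E3] := tE; move: wU; rewrite inE => wU.
have n1 := out x1; have n2 := out x2; have n3 := out x3.
have m1 := out y1; have m2 := out y2; have m3 := out y3.
move: n1 n2 n3 m1 m2 m3; rewrite !inE !eqxx !orbT.
move=> /(_ isT) n1 /(_ isT) n2 /(_ isT) n3 /(_ isT) m1 /(_ isT) m2 /(_ isT) m3.
expand wU; expand U.
have kill b c d f : e = w |: [set b; c] -> [set c; d; f] \in E ->
    uniq [:: w; b; c; d; f] ->
    b \notin e' -> c \notin e' -> d \notin e' -> f \notin e' -> False.
  move=> eq_e' cdfE wbc; apply: (no_pendant uE pE e'E wbc) => //.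
  by rewrite -setUA -eq_e'.
have E2' : [set x1; y2; x3] \in E by have -> : [set x1; y2; x3] = [set x3; y2; x1] by seteq.
move: pN; rewrite !inE => /orP[|/orP[|/orP[|/orP[|/orP[]]]]] /eqP p_eq;
  rewrite p_eq in eq_e.
- apply: (kill x2 x3 y2 x1) => //; distinct.
- by apply: (kill x3 x1 y3 x2) => //; distinct.
- by apply: (kill x1 x2 y1 x3) => //; distinct.
- by apply: (kill y1 x1 y3 x2); rewrite // 1?[[set y1; x1]]setUC //; distinct.
- by apply: (kill y2 x2 y1 x3); rewrite // 1?[[set y2; x2]]setUC //; distinct.
- by apply: (kill y3 x3 y2 x1); rewrite // 1?[[set y3; x3]]setUC //; distinct.
Qed.

(** The path is [w x2 x3], [x3 y2 x1], [x1 y1 w']. *)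
Lemma side_spoke_path (V : finType) (E : {set {set V}})
    (x1 x2 x3 y1 y2 y3 w w' : V) :
  path_free E -> triangle_in E x1 x2 x3 y1 y2 y3 -> w != w' ->
  w \notin core x1 x2 x3 y1 y2 y3 -> w' \notin core x1 x2 x3 y1 y2 y3 ->
  (w |: [set x2; x3] \in E) + (w' |: [set x1; y1] \in E) <= 1.
Proof.
move=> pE [U _ E2 _] ww'; rewrite !inE => wU w'U.
case wE: (_ \in E); case w'E: (_ \in E) => //; exfalso.
expand U; expand wU; expand w'U.
apply: (pE w x2 x3 y2 x1 y1 w') => //; first by distinct.
- by rewrite -setUA.
- by rewrite setUC.
Qed.

Definition attachments (V : finType) (E : {set {set V}}) (ps : seq {set V}) (w : V) :=
  count (fun p => w |: p \in E) ps.

(** Match each pair of the net for [w] with its disjoint partner for [w']: by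
    [side_spoke_path], each of the six matches contributes at most one edge. *)
Lemma attachments_pair (V : finType) (E : {set {set V}})
    (x1 x2 x3 y1 y2 y3 w w' : V) :
  path_free E -> triangle_in E x1 x2 x3 y1 y2 y3 -> w != w' ->
  w \notin core x1 x2 x3 y1 y2 y3 -> w' \notin core x1 x2 x3 y1 y2 y3 ->
  attachments E (net x1 x2 x3 y1 y2 y3) w
    + attachments E (net x1 x2 x3 y1 y2 y3) w' <= 6.
Proof.
move=> pE tE ww' wU w'U.
have coreE : core x2 x3 x1 y2 y3 y1 = core x1 x2 x3 y1 y2 y3 by seteq.
have coreE' : core x3 x1 x2 y3 y1 y2 = core x1 x2 x3 y1 y2 y3 by seteq.
have side z z' : z != z' -> z \notin core x1 x2 x3 y1 y2 y3 ->
    z' \notin core x1 x2 x3 y1 y2 y3 ->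
    [/\ (z |: [set x2; x3] \in E) + (z' |: [set x1; y1] \in E) <= 1,
        (z |: [set x3; x1] \in E) + (z' |: [set x2; y2] \in E) <= 1 &
        (z |: [set x1; x2] \in E) + (z' |: [set x3; y3] \in E) <= 1].
  move=> zz' zU z'U; split; first exact: side_spoke_path tE zz' zU z'U.
    by apply: (side_spoke_path pE (triangle_rot tE)); rewrite ?coreE.
  by apply: (side_spoke_path pE (triangle_rot (triangle_rot tE))); rewrite ?coreE'.
have [a1 a2 a3] := side w w' ww' wU w'U.
have [|b1 b2 b3] := side w' w _ w'U wU; first by rewrite eq_sym.
rewrite /attachments /=; move: a1 a2 a3 b1 b2 b3.
do 12! move: (nat_of_bool _) => ?; lia.
Qed.

Lemma star_attachments (V : finType) (E : {set {set V}})
    (x1 x2 x3 y1 y2 y3 w : V) :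
  uniform3 E -> path_free E -> triangle_in E x1 x2 x3 y1 y2 y3 ->
  w \notin core x1 x2 x3 y1 y2 y3 ->
  (exists e, [/\ e \in E, w \in e & ~~ [disjoint e & core x1 x2 x3 y1 y2 y3]]) ->
  #|[set e in E | w \in e]| <= attachments E (net x1 x2 x3 y1 y2 y3) w.
Proof.
move=> uE pE tE wU [e0 [e0E we0 meet]].
rewrite /attachments -size_filter -(size_map (fun p => w |: p)).
apply: leq_trans (card_size _); apply/subset_leq_card/subsetP => e.
rewrite inE => /andP[eE we].
have [p pN eq_e] := attached_net uE pE tE eE we wU
  (attached_closed uE pE tE e0E eE we0 we wU meet).
by apply/mapP; exists p; rewrite // mem_filter -eq_e eE.
Qed.

(** * Edges inside the core of a triangle *)

(** The path is [e], [w p q], [U :\: e]. *)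
Lemma no_complementary_pair (V : finType) (E : {set {set V}}) (U e : {set V})
    (w p q : V) :
  uniform3 E -> path_free E -> w \notin U -> [set w; p; q] \in E ->
  e \in E -> e \subset U -> U :\: e \in E ->
  p \in e -> q \in U :\: e -> False.
Proof.
move=> uE pE wU wpqE eE eU fE pe qf.
have [b [b' [eq_e pb pb' bb']]] := card3_split (uniform3_card uE eE) pe.
have [d [d' [eq_f qd qd' dd']]] := card3_split (uniform3_card uE fE) qf.
have fe z : z \in U :\: e -> z \notin e by rewrite inE => /andP[].
have fU z : z \in U :\: e -> z \in U by rewrite inE => /andP[].
have eU' := subsetP eU.
have be : b \in e by rewrite eq_e !inE eqxx orbT.
have b'e : b' \in e by rewrite eq_e !inE eqxx !orbT.
have df : d \in U :\: e by rewrite eq_f !inE eqxx orbT.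
have d'f : d' \in U :\: e by rewrite eq_f !inE eqxx !orbT.
have [qe de d'e] := And3 (fe q qf) (fe d df) (fe d' d'f).
have [bU b'U pU] := And3 (eU' b be) (eU' b' b'e) (eU' p pe).
have [qU dU d'U] := And3 (fU q qf) (fU d df) (fU d' d'f).
apply: (pE b b' p w q d d'); first by distinct.
- by have -> : [set b; b'; p] = e by rewrite eq_e; seteq.
- by have -> : [set p; w; q] = [set w; p; q] by seteq.
- by have -> : [set q; d; d'] = U :\: e by rewrite eq_f.
Qed.

(** Complementation in [U] preserves the 12 triples that separate [p] from [q],
    and by [no_complementary_pair] at most one triple of each complementary pair
    is an edge: 6 edges at most. The other 8 triples are those of the four
    vertices other than [p] and [q], and their complements. *)
Lemma spanned_le14 (V : finType) (E : {set {set V}}) (U : {set V}) (w p q : V) :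
  uniform3 E -> path_free E -> #|U| = 6 -> w \notin U -> p \in U -> q \in U ->
  p != q -> [set w; p; q] \in E -> #|spanned E U| <= 14.
Proof.
move=> uE pE U6 wU pU qU pq wpqE.
pose triples (A : {set V}) := [set e : {set V} | e \subset A & #|e| == 3].
pose split := [set e in triples U | (p \in e) != (q \in e)].
have kappa_inj : {in triples U &, injective (fun e => U :\: e)}.
  move=> e f; rewrite !inE => /andP[eU _] /andP[fU _] /(congr1 (setD U)).
  by rewrite !setDDr !setDv !set0U (setIidPr eU) (setIidPr fU).
have kappa_triples e : e \in triples U -> U :\: e \in triples U.
  rewrite !inE subsetDl => /andP[eU /eqP e3].
  by rewrite cardsD (setIidPr eU) e3 U6.
have FT : spanned E U \subset triples U.
  apply/subsetP => e; rewrite !inE => /andP[eE ->].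
  by rewrite (uniform3_card uE eE).
have T20 : #|triples U| = 20 by rewrite cards_draws U6.
have disj : [disjoint spanned E U & (fun e => U :\: e) @: (spanned E U :&: split)].
  apply/pred0P => f; apply/negP => /andP[/= fF /imsetP[e]].
  rewrite in_setI => /andP[eF eS] eq_f; move: fF eF eS.
  rewrite eq_f !inE => /andP[fE _] /andP[eE eU] /andP[_].
  case pe: (p \in e); case qe: (q \in e) => // _.
    by apply: (no_complementary_pair (U := U) uE pE wU wpqE eE eU fE pe); rewrite inE qe.
  apply: (no_complementary_pair (U := U) (p := q) (q := p) uE pE wU _ eE eU fE qe).
    by have -> : [set w; q; p] = [set w; p; q] by seteq.
  by rewrite inE pe.
have sum20 : #|spanned E U| + #|spanned E U :&: split| <= 20.
  rewrite -T20 -(card_in_imset (f := fun e => U :\: e) (D := mem (spanned E U :&: split))).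
    rewrite -cardsUI (disjoint_setI0 disj) cards0 addn0; apply: subset_leq_card.
    rewrite subUset FT; apply/subsetP => _ /imsetP[e /setIP[/(subsetP FT) eT _] ->].
    exact: kappa_triples.
  by move=> e f /setIP[/(subsetP FT) eT _] /setIP[/(subsetP FT) fT _]; apply: kappa_inj.
have rest8 : #|spanned E U :\: split| <= 8.
  pose Q := U :\ p :\ q.
  have Q4 : #|Q| = 4.
    have := cardsD1 q (U :\ p); rewrite !inE eq_sym pq qU -/Q /=.
    by have := cardsD1 p U; rewrite pU U6 /= !add1n => -[<-] [].
  have N4 : #|triples Q| = 4 by rewrite cards_draws Q4.
  have sub : spanned E U :\: split \subset
      triples Q :|: (fun e => U :\: e) @: triples Q.
    apply/subsetP => e; rewrite !inE => /andP[nsplit /andP[eE eU]].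
    have e3 := uniform3_card uE eE; move: nsplit; rewrite eU e3 /= negbK => /eqP pqe.
    have eQ (f : {set V}) : f \subset U -> #|f| = 3 -> p \notin f -> q \notin f -> f \in triples Q.
      by move=> fU f3 pf qf; rewrite inE f3 !subsetD1 fU pf qf.
    case qe: (q \in e) pqe => pe; last first.
      have := eQ e eU e3; rewrite pe qe => /(_ isT isT).
      by rewrite inE e3 andbT => ->.
    apply/orP; right; apply/imsetP; exists (U :\: e).
      apply: eQ; rewrite ?subsetDl // ?inE ?pe ?qe //.
      by rewrite cardsD (setIidPr eU) e3 U6.
    by rewrite setDDr setDv set0U (setIidPr eU).
  apply: leq_trans (subset_leq_card sub) _.
  apply: leq_trans (leq_card_setU _ _) _.
  by rewrite N4 -[8]/(4 + 4) leq_add2l -N4 leq_imset_card.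
move: sum20 rest8; rewrite -(cardsID split (spanned E U)).
move: #|_ :&: _| #|_ :\: _| => i d; lia.
Qed.

(** * Decomposition around a triangle *)

(** If some [d w] exceeds 3, then every other value is at most 2. *)
Lemma sum_le_triple (T : finType) (W : {set T}) (d : T -> nat) :
  1 < #|W| -> {in W &, forall w w', w != w' -> d w + d w' <= 6} ->
  \sum_(w in W) d w <= 3 * #|W|.
Proof.
move=> W2 d6.
case: (boolP [forall w in W, d w <= 3]) => [/forall_inP d3|].
  by rewrite mulnC -sum_nat_const leq_sum.
rewrite negb_forall_in => /exists_inP[w0 w0W]; rewrite -ltnNge => d0.
have /card_gt0P[w1] : 0 < #|W :\ w0| by move: W2; rewrite (cardsD1 w0) w0W.
rewrite !inE => /andP[w10 w1W].
have W1W : w1 \in W :\ w0 by rewrite !inE w10.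
rewrite (big_setD1 w0) //= (big_setD1 w1) //= (cardsD1 w0) w0W (cardsD1 w1) W1W.
have d01 := d6 w0 w1 w0W w1W; rewrite eq_sym in w10; move/(_ w10) in d01.
have le3 : \sum_(w in W :\ w0 :\ w1) d w <= 3 * #|W :\ w0 :\ w1|.
  rewrite mulnC -sum_nat_const; apply: leq_sum => w; rewrite !inE.
  by case/and3P=> _ w0w wW; rewrite eq_sym in w0w; have := d6 w0 w w0W wW w0w; lia.
by move: le3 d01; lia.
Qed.

Lemma card_bigcup_le (T I : finType) (W : {set I}) (F : I -> {set T}) :
  #|\bigcup_(i in W) F i| <= \sum_(i in W) #|F i|.
Proof.
elim/big_rec2: _ => [|i n A _ le_n]; first by rewrite cards0.
by apply: leq_trans (leq_card_setU _ _) _; rewrite leq_add2l.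
Qed.

Lemma card_core (V : finType) (x1 x2 x3 y1 y2 y3 : V) :
  uniq [:: x1; x2; x3; y1; y2; y3] -> #|core x1 x2 x3 y1 y2 y3| = 6.
Proof. by move=> U; rewrite cardsE; apply/card_uniqP. Qed.

Lemma spanned_le (V : finType) (E : {set {set V}}) (U : {set V}) :
  uniform3 E -> #|spanned E U| <= 'C(#|U|, 3).
Proof.
move=> uE; rewrite -cards_draws; apply/subset_leq_card/subsetP => e.
by rewrite !inE => /andP[eE ->]; rewrite (uniform3_card uE eE).
Qed.

(** A bound on the number of edges that meet the core when [k] vertices are
    attached to it: 20 triples of the core for [k = 0], [14 + 6] for [k = 1] and
    [14 + 3 k] beyond. *)
Definition triangle_bound k := if k <= 1 then 20 else 14 + 3 * k.

(** The case [#|W| = 0] keeps the edges inside the core apart, since the extremal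
    structure is read off from them. *)
Lemma triangle_decomposition (V : finType) (E : {set {set V}}) (S : {set V})
    (x1 x2 x3 y1 y2 y3 : V) :
  uniform3 E -> path_free E -> (forall e, e \in E -> e \subset S) ->
  triangle_in E x1 x2 x3 y1 y2 y3 ->
  let U := core x1 x2 x3 y1 y2 y3 in
  exists W : {set V}, [/\ W \subset S :\: U,
    0 < #|W| -> #|E| <= triangle_bound #|W| + #|spanned E (S :\: U :\: W)| &
    #|W| = 0 -> #|E| <= #|spanned E U| + #|spanned E (S :\: U)|].
Proof.
move=> uE pE ES tE U.
pose W := [set w in S :\: U | [exists e in E, (w \in e) && ~~ [disjoint e & U]]].
have WP w : w \in W -> w \notin U /\
    exists e, [/\ e \in E, w \in e & ~~ [disjoint e & U]].
  rewrite !inE => /andP[/andP[wU wS] /exists_inP[e eE /andP[we meet]]].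
  by split; last by exists e.
pose star w := [set e in E | w \in e].
have cover : E \subset spanned E U :|: (\bigcup_(w in W) star w)
    :|: spanned E (S :\: U :\: W).
  apply/subsetP => e eE; rewrite in_setU in_setU.
  case: (boolP (e \subset U)) => [eU|]; first by rewrite inE eE eU.
  case/subsetPn => w we wU.
  case: (boolP [exists z in W, z \in e]) => [/exists_inP[z zW ze]|none].
    suff -> : e \in \bigcup_(z in W) star z by rewrite orbT.
    by apply/bigcupP; exists z; rewrite // inE eE ze.
  have nW z : z \in e -> z \notin W.
    move=> ze; apply/negP => zW; case/negP: none.
    by apply/exists_inP; exists z.
  rewrite [e \in spanned E (_ :\: W)]inE eE /=.
  suff -> : e \subset S :\: U :\: W by rewrite orbT.
  apply/subsetP => z ze; rewrite in_setD nW // in_setD (subsetP (ES e eE)) // andbT.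
  apply/negP => zU; case/negP: (nW w we); rewrite inE in_setD wU (subsetP (ES e eE)) //=.
  by apply/exists_inP; exists e; rewrite // we; apply/pred0Pn; exists z; rewrite /= ze.
have [uU _ _ _] := tE.
have leE := subset_leq_card cover.
have {}leE : #|E| <= #|spanned E U| + \sum_(w in W) #|star w| + #|spanned E (S :\: U :\: W)|.
  apply: leq_trans leE (leq_trans (leq_card_setU _ _) _); rewrite leq_add2r.
  by apply: leq_trans (leq_card_setU _ _) _; rewrite leq_add2l card_bigcup_le.
exists W; split.
- by apply/subsetP => w; rewrite inE => /andP[].
- move=> W0; apply: leq_trans leE _; rewrite leq_add2r.
  have le14 : #|spanned E U| <= 14.
    have [w /WP[wU [e [eE we meet]]]] := card_gt0P W0.
    have [p pN eq_e] := attached_net uE pE tE eE we wU meet.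
    have U6 := card_core uU.
    have bound a b : a \in U -> b \in U -> a != b -> e = w |: [set a; b] ->
        #|spanned E U| <= 14.
      move=> aU bU ab eq_ab; apply: (spanned_le14 uE pE U6 wU aU bU ab).
      by rewrite -setUA -eq_ab.
    move: (uU) => uU'; expand uU'.
    move: pN; rewrite !inE => /orP[|/orP[|/orP[|/orP[|/orP[]]]]] /eqP p_eq;
      rewrite p_eq in eq_e.
    + by apply: (bound x2 x3); rewrite // !inE eqxx ?orbT.
    + by apply: (bound x3 x1); rewrite ?inE ?eqxx ?orbT // eq_sym.
    + by apply: (bound x1 x2); rewrite // !inE eqxx ?orbT.
    + by apply: (bound x1 y1); rewrite // !inE eqxx ?orbT.
    + by apply: (bound x2 y2); rewrite // !inE eqxx ?orbT.
    + by apply: (bound x3 y3); rewrite // !inE eqxx ?orbT.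
  (* A single vertex of [W] may have all six attachments; with two or more, the
     average is at most three. *)
  pose N := net x1 x2 x3 y1 y2 y3.
  have dW w : w \in W -> #|star w| <= attachments E N w.
    by case/WP=> wU ex; apply: star_attachments.
  rewrite /triangle_bound; case: (leqP #|W| 1) => W1.
    have /cards1P[w defW] : #|W| == 1 by rewrite eqn_leq W1.
    rewrite defW big_set1 -[20]/(14 + 6); apply: leq_add => //.
    apply: leq_trans (dW w _) _; first by rewrite defW inE.
    exact: count_size.
  apply: leq_add => //; apply: leq_trans (leq_sum _ (fun w => @dW w)) _.
  apply: sum_le_triple => // w w' /WP[wU _] /WP[w'U _] ww'.
  exact: attachments_pair.
move/eqP; rewrite cards_eq0 => /eqP W0; move: leE.
by rewrite W0 big_set0 addn0 setD0.
Qed.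

(** * Graphs rigid with respect to a family of triples *)

Lemma bin2_mul2 n : 'C(n, 2) * 2 = n * n.-1.
Proof. by rewrite muln2 bin2 even_halfK // oddM; case: n => //= n; rewrite andNb. Qed.

(** Double counting of the incidences between [S] and [P]. *)
Lemma degree_sum (T : finType) (c : nat) (S : {set T}) (P : {set {set T}}) :
  (forall e, e \in P -> e \subset S /\ #|e| = c) ->
  \sum_(x in S) #|[set e in P | x \in e]| = c * #|P|.
Proof.
move=> PS; transitivity (\sum_(x in S) \sum_(e in P) (x \in e : nat)).
  apply: eq_bigr => x _; rewrite -sum1_card big_mkcond [RHS]big_mkcond /=.
  by apply: eq_bigr => e _; rewrite inE; case: (e \in P).
rewrite exchange_big mulnC -sum_nat_const; apply: eq_bigr => e /PS[eS <-].
rewrite -sum1_card big_mkcond [RHS]big_mkcond /=; apply: eq_bigr => x _.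
by case: (boolP (x \in e)) => [/(subsetP eS)->|] //; case: (x \in S).
Qed.

Lemma card_pairs_at (T : finType) (P : {set {set T}}) (u : T) (B : {set T}) :
  (forall l, l \in P -> exists2 y, y \in B & l = [set u; y]) -> #|P| <= #|B|.
Proof.
move=> PB; apply: leq_trans (leq_imset_card (fun y => [set u; y]) B).
by apply/subset_leq_card/subsetP => l /PB[y yB ->]; apply: imset_f.
Qed.

Lemma card2_split (T : finType) (l : {set T}) (u : T) : #|l| = 2 -> u \in l ->
  exists2 y, y != u & l = [set u; y].
Proof.
move=> l2 ul; have /cards1P[y ly] : #|l :\ u| == 1.
  by move: l2; rewrite (cardsD1 u) ul add1n => -[->].
have : y \in l :\ u by rewrite ly inE.
by rewrite !inE => /andP[yu _]; exists y; rewrite // -ly setD1K.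
Qed.

(** The property of the link [L] of a vertex, and of the set [G] of edges avoiding
    this vertex, that [link_rigid] establishes. The next two lemmas concern only
    such a graph [L] and family of triples [G]. *)
Definition crossing_rigid (T : finType) (L G : {set {set T}}) : Prop :=
  forall g l l', g \in G -> l \in L -> l' \in L ->
    ~~ [disjoint l & g] -> ~~ (l \subset g) -> [disjoint l & l'] -> l' = g :\: l.

(** Let [l = u z] cross [g = u v w] at [u]. Every link edge off [u] other than
    [v w] contains all outer neighbours of [u]; as [L] has more edges than there
    are vertices, [z] is the only outer neighbour. Then [L] lies in the triangle
    on [g] together with the star at [z], and at least two edges of this
    triangle are present. By rigidity no edge [z y] with [y] outside [g] crosses
    a member of [G], so a member of [G] contains [z] and all these [y], or none
    of them. Few triples are of either kind. *)
Lemma crossing_small (T : finType) (N : {set T}) (L G : {set {set T}})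
    (g l : {set T}) :
  6 < #|N| ->
  (forall l, l \in L -> l \subset N /\ #|l| = 2) ->
  (forall g, g \in G -> g \subset N /\ #|g| = 3) ->
  crossing_rigid L G -> #|N| < #|L| ->
  g \in G -> l \in L -> ~~ [disjoint l & g] -> ~~ (l \subset g) ->
  #|L| + #|G| < 'C(#|N|, 2).
Proof.
move=> N7 LN GN rigid bigL gG lL meet /subsetPn[z zl zg].
have [lN l2] := LN l lL; have [gN g3] := GN g gG.
case/pred0Pn: meet => u /andP[/= ul ug].
have uz : u != z := mem_notin_neq ug zg.
have uN := subsetP gN u ug; have zN := subsetP lN z zl.
have [v [w [eq_g uv uw vw]]] := card3_split g3 ug.
have eq_l : l = [set u; z].
  have [y yu eq_l] := card2_split l2 ul; move: zl; rewrite eq_l !inE.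
  by rewrite eq_sym (negbTE uz) /= => /eqP->.
pose A := [set z' in N :\: g | [set u; z'] \in L].
have zA : z \in A by rewrite !inE zg zN -eq_l.
have gDu z' : z' \notin g -> g :\: [set u; z'] = [set v; w].
  rewrite eq_g => z'g; apply/setP => t; rewrite !inE; move: z'g; rewrite !inE.
  rewrite !negb_or => /andP[/andP[z'u z'v] z'w].
  case: (eqVneq t u) => [->|_] /=; first by rewrite (negbTE uv) (negbTE uw).
  case: (eqVneq t z') => [->|_] //=; by rewrite (negbTE z'v) (negbTE z'w).
have covered l' : l' \in L -> u \notin l' -> l' != [set v; w] -> A \subset l'.
  move=> l'L ul' l'vw; apply/subsetP => z'; rewrite !inE => /andP[/andP[z'g z'N] uz'L].
  apply: contraR l'vw => z'l'; apply/eqP; rewrite -(gDu z' z'g).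
  apply: (rigid _ _ _ gG uz'L l'L).
  - by apply/pred0Pn; exists u; rewrite /= !inE eqxx.
  - by apply/subsetPn; exists z'; rewrite // !inE eqxx orbT.
  rewrite disjoint_sym disjoint_subset; apply/subsetP => t tl'; rewrite !inE negb_or.
  by rewrite (mem_notin_neq tl' ul') (mem_notin_neq tl' z'l').
have atu l' : l' \in L -> u \in l' ->
    exists2 y, y \in [set v; w] :|: A & l' = [set u; y].
  move=> l'L ul'; have [l'N l'2] := LN l' l'L.
  have [y yu eq_l'] := card2_split l'2 ul'; exists y => //.
  have yN : y \in N by rewrite (subsetP l'N) // eq_l' !inE eqxx orbT.
  by rewrite !inE yN -eq_l' l'L eq_g !inE (negbTE yu); case: (y == v); case: (y == w).
(* With three outer neighbours, [L] is a star at [u] plus [v w]; with two, it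
   has at most 4 edges at [u], plus [v w], plus [A] itself. *)
have A1 : A = [set z].
  apply/eqP; rewrite eq_sym eqEcard sub1set zA cards1 leqNgt; apply/negP => A2.
  pose Lu := [set l' in L | u \in l'].
  have Lu_le : #|Lu| <= 2 + #|A|.
    have := @card_pairs_at _ Lu u ([set v; w] :|: A).
    move=> le; apply: leq_trans (le _) _.
      by move=> l'; rewrite inE => /andP[]; apply: atu.
    by apply: leq_trans (leq_card_setU _ _) _; rewrite cards2 vw.
  have Lu_le' : #|Lu| <= #|N|.-1.
    have -> : #|N|.-1 = #|N :\ u| by rewrite (cardsD1 u N) uN.
    apply: (@card_pairs_at _ _ u) => l'; rewrite inE => /andP[l'L ul'].
    have [l'N l'2] := LN l' l'L; have [y yu eq_l'] := card2_split l'2 ul'.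
    by exists y; rewrite // !inE yu (subsetP l'N) // eq_l' !inE eqxx orbT.
  have LsubA : L \subset Lu :|: [set [set v; w]] :|: [set l' in L | A \subset l'].
    apply/subsetP => l' l'L; rewrite !inE l'L /=.
    case: (boolP (u \in l')) => //= ul'; case: eqP => //= /eqP; exact: covered.
  have third : #|[set l' in L | A \subset l']| <= (#|A| == 2).
    case: (eqVneq #|A| 2) => [cA|cA].
      rewrite /= -(cards1 A); apply/subset_leq_card/subsetP => l'.
      rewrite !inE => /andP[/LN[_ l'2] Al'].
      by rewrite eq_sym eqEcard Al' l'2 cA.
    rewrite leqn0 cards_eq0; apply/eqP/setP => l'; rewrite !inE.
    apply/negP => /andP[/LN[_ l'2] /subset_leq_card]; rewrite l'2.
    by move: cA A2; move: #|A| => a; clear; lia.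
  have := leq_trans (subset_leq_card LsubA) (leq_card_setU _ _).
  have [+ _] := leq_card_setU Lu [set [set v; w]]; rewrite cards1.
  move: bigL Lu_le Lu_le' third A2 N7.
  move: #|_ :|: _| #|[set _ | _]| #|_| #|_| #|_| #|_| => a b c d e f.
  by case: eqP; clear; lia.
pose I := [set l' in L | l' \subset g]; pose Lz := [set l' in L | z \in l'].
have LIz : L \subset I :|: Lz.
  apply/subsetP => l' l'L; rewrite !inE l'L /=.
  case: (boolP (u \in l')) => ul'.
    have [y] := atu l' l'L ul'; rewrite A1 !inE => /orP[yvw|/eqP->] ->.
      by rewrite subUset !sub1set ug eq_g !inE -orbA yvw orbT.
    by rewrite !inE eqxx !orbT.
  case: (eqVneq l' [set v; w]) => [->|/(covered _ l'L ul')].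
    by rewrite subUset !sub1set eq_g !inE !eqxx !orbT.
  by rewrite A1 sub1set => ->; rewrite orbT.
have I3 : #|I| <= 3.
  have <- : 'C(#|g|, 2) = 3 by rewrite g3.
  rewrite -cards_draws; apply/subset_leq_card/subsetP => l'.
  by rewrite !inE => /andP[/LN[_ ->] ->].
have atz l' : l' \in L -> z \in l' -> exists2 y, y \in N :\ z & l' = [set z; y].
  move=> l'L zl'; have [l'N l'2] := LN l' l'L; have [y yz eq_l'] := card2_split l'2 zl'.
  by exists y; rewrite // !inE yz (subsetP l'N) // eq_l' !inE eqxx orbT.
have Lz_le : #|Lz| <= #|N|.-1.
  have -> : #|N|.-1 = #|N :\ z| by rewrite (cardsD1 z N) zN.
  by apply: (@card_pairs_at _ _ z) => l'; rewrite inE => /andP[]; apply: atz.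
pose Y := [set y in N :\: g | (y != z) && ([set z; y] \in L)].
have Lz_Y : #|Lz| <= 3 + #|Y|.
  rewrite -g3; apply: leq_trans (leq_card_setU g Y).
  apply: (@card_pairs_at _ _ z) => l'; rewrite inE => /andP[l'L zl'].
  have [y yNz eq_l'] := atz l' l'L zl'; exists y => //; move: yNz; rewrite !inE.
  by case: (y \in g) => //= /andP[-> ->]; rewrite -eq_l' l'L.
have L_le : #|L| <= #|I| + #|Lz|.
  exact: leq_trans (subset_leq_card LIz) (leq_card_setU _ _).
have I2 : 1 < #|I| by move: bigL N7 I3 Lz_le Lz_Y L_le; move: #|L| #|N| #|I| #|Lz| #|Y|; clear; lia.
(* If [z y] crossed [g'], all edges of [I], being disjoint from [z y], would be
   equal to [g'] minus [z y]. *)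
have zyE g' y : g' \in G -> y \in Y -> (z \in g') = (y \in g').
  rewrite !inE => g'G /andP[/andP[yg yN] /andP[yz zyL]].
  apply/eqP; apply: contraTT I2 => zy; rewrite -leqNgt.
  rewrite -(cards1 (g' :\: [set z; y])); apply/subset_leq_card/subsetP => l'.
  rewrite !inE => /andP[l'L l'g]; apply/eqP; apply: (rigid _ _ _ g'G zyL l'L).
  - apply/pred0Pn; case: (boolP (z \in g')) zy => zg' yg'.
      by exists z; rewrite /= !inE eqxx.
    by exists y; rewrite /= !inE eqxx orbT; case: (y \in g') yg'.
  - by rewrite subUset !sub1set; case: (z \in g') (y \in g') zy => [] [].
  rewrite disjoint_sym disjoint_subset; apply/subsetP => t /(subsetP l'g) tg.
  by rewrite !inE negb_or (mem_notin_neq tg zg) (mem_notin_neq tg yg).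
have zY : z \notin Y by rewrite !inE eqxx !andbF.
have cZY : #|z |: Y| = #|Y|.+1 by rewrite cardsU1 zY.
have Y2 : #|Y| >= #|N| - 5 by move: bigL I3 Lz_Y L_le; move: #|L| #|N| #|I| #|Lz| #|Y|; clear; lia.
have ZYN : z |: Y \subset N.
  rewrite subUset sub1set zN; apply/subsetP => y.
  by rewrite !inE => /andP[/andP[]].
(* One triple can contain [z] and [Y]; the others lie in the at most four
   vertices outside of [z] and [Y]. *)
have G_le : #|G| <= 5.
  have Gsub : G \subset [set z |: Y]
      :|: [set g' : {set T} | g' \subset N :\: (z |: Y) & #|g'| == 3].
    apply/subsetP => g' g'G; have [g'N g'3] := GN g' g'G; rewrite !inE g'3 andbT.
    case: (boolP (z \in g')) => zg'.
      rewrite eq_sym eqEcard cZY g'3 subUset sub1set zg' /=.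
      have -> : Y \subset g' by apply/subsetP => y yY; rewrite -(zyE g' y).
      by rewrite ltnS (leq_trans _ Y2) //; move: N7; move: #|N|; clear; lia.
    rewrite subsetD g'N disjoint_subset; apply/orP; right.
    apply/subsetP => t tg'; rewrite inE /= in_setU1 negb_or (mem_notin_neq tg' zg') /=.
    by apply: contra zg' => tY; rewrite (zyE g' t).
  apply: leq_trans (subset_leq_card Gsub) (leq_trans (leq_card_setU _ _) _).
  rewrite cards1 -[5]/(1 + 'C(4, 3)) leq_add2l cards_draws leq_bin2l //.
  by rewrite cardsD (setIidPr ZYN) cZY; move: Y2 N7; move: #|N| #|Y|; clear; lia.
have : #|N| * 6 <= #|N| * #|N|.-1 by rewrite leq_mul2l -ltnS (ltn_predK N7) N7 orbT.
have := bin2_mul2 #|N|; move: L_le G_le I3 Lz_le N7.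
by move: (#|N| * #|N|.-1) #|L| #|G| #|I| #|Lz| #|N| 'C(_, 2); clear; lia.
Qed.

(** A vertex [u] covered by some [g] in [G] has its link neighbours in [g], so at
    most two of them; hence at most [#|cover G|] link edges meet [cover G]. *)
Lemma noncrossing_le (T : finType) (N : {set T}) (L G : {set {set T}}) :
  (forall l, l \in L -> l \subset N /\ #|l| = 2) ->
  (forall g, g \in G -> #|g| = 3) ->
  (forall g l, g \in G -> l \in L -> ~~ [disjoint l & g] -> l \subset g) ->
  #|L| <= #|cover G| + 'C(#|N :\: cover G|, 2).
Proof.
move=> LN G3 nocross; set C := cover G.
pose LC := [set l in L | l \subset C].
have LC_le : #|LC| <= #|C|.
  have deg : \sum_(u in C) #|[set l in LC | u \in l]| = 2 * #|LC|.
    by apply: degree_sum => l; rewrite inE => /andP[/LN[_ l2] lC].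
  rewrite -(leq_pmul2l (m := 2)) // -deg mulnC -sum_nat_const; apply: leq_sum => u.
  case/bigcupP=> g gG ug; have g3 := G3 g gG.
  have <- : #|g :\ u| = 2 by move: g3; rewrite (cardsD1 u) ug add1n => -[].
  apply: (@card_pairs_at _ _ u) => l; rewrite !inE => /andP[/andP[lL _] ul].
  have [y yu eq_l] := card2_split (LN l lL).2 ul; exists y => //.
  rewrite !inE yu (subsetP (nocross g l gG lL _)) ?eq_l ?inE ?eqxx ?orbT //.
  by rewrite -eq_l; apply/pred0Pn; exists u; rewrite /= ul.
have LsubC : L \subset LC :|: [set l : {set T} | l \subset N :\: C & #|l| == 2].
  apply/subsetP => l lL; have [lN l2] := LN l lL; rewrite !inE lL l2 /=.
  rewrite andbT subsetD lN /=; apply/orP.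
  case: (boolP [disjoint l & C]) => [|/pred0Pn[u /andP[/= ul]]]; first by right.
  case/bigcupP=> g gG ug; left; apply: subset_trans (bigcup_sup g gG).
  by apply: nocross lL _ => //; apply/pred0Pn; exists u; rewrite /= ul.
apply: leq_trans (subset_leq_card LsubC) (leq_trans (leq_card_setU _ _) _).
by rewrite cards_draws leq_add2r.
Qed.

(** For [r <= 7] the trivial bound is good enough for the induction. The sharp
    value 20 for [r = 7] is needed only once, see [seven_vertices_le20]. *)
Definition turan_bound r := if r <= 7 then 'C(r, 3) else 'C(r.-1, 2).

Lemma bin2D s t : 'C(s + t, 2) = 'C(s, 2) + s * t + 'C(t, 2).
Proof.
elim: s => [|s IH]; first by rewrite bin0n.
by rewrite addSn !binS !bin1 IH mulSn; lia.
Qed.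

(** Here the link [L] lives on [m] vertices, [t] is the size of [cover G], [a = |L|]
    and [b = |G|]. Since [m < a], at least four vertices are not covered. So the
    pairs that meet [cover G], of which the link has at most [t], outnumber
    [t + b]. *)
Lemma noncrossing_arith m t a b : 6 < m -> 2 < t -> t <= m -> m < a ->
  a <= t + 'C(m - t, 2) -> b <= turan_bound t -> a + b < 'C(m, 2).
Proof.
move=> m7 t3 tm; rewrite -(subnKC tm) addKn; move: (m - t) => s {tm};
rewrite bin2D => big le_a le_b.
have s4 : 3 < s.
  rewrite ltnNge; apply/negP => s3; have := leq_trans big le_a.
  by rewrite ltn_add2l ltnNge => /negP[]; case: s s3 {big le_a} => [|[|[|[]]]].
have ts : t * 4 <= t * s by rewrite leq_mul2l s4 orbT.
have le : turan_bound t + t < 'C(t, 2) + t * 4.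
  rewrite /turan_bound; case: (leqP t 7) => t7.
    by clear -t3 t7; case: t t3 t7 => [|[|[|[|[|[|[|[|t]]]]]]]].
  clear -t7; case: t t7 => // t t7; rewrite binS bin1 /=.
  by move: 'C(t, 2); clear -t7; lia.
move: le_b le le_a ts; move: (turan_bound t) 'C(t, 2) 'C(s, 2) (t * s).
by clear; lia.
Qed.

(** * Links in triangle-free 3-graphs *)

Definition link (V : finType) (E : {set {set V}}) (x : V) : {set {set V}} :=
  [set l : {set V} | (x \notin l) && (x |: l \in E)].

Lemma card_link (V : finType) (E : {set {set V}}) (x : V) :
  #|link E x| = #|[set e in E | x \in e]|.
Proof.
rewrite -(card_in_imset (f := fun l => x |: l) (D := mem (link E x))); last first.
  move=> l l'; rewrite !inE => /andP[xl _] /andP[xl' _] /(congr1 (fun e => e :\ x)).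
  by rewrite !setU1K.
apply: eq_card => e; rewrite inE; apply/imsetP/andP.
  by case=> l; rewrite inE => /andP[_ lE] ->; rewrite setU11.
by case=> eE xe; exists (e :\ x); rewrite ?setD1K // !inE eqxx setD1K.
Qed.

Definition triangle_free (V : finType) (E : {set {set V}}) : Prop :=
  forall x1 x2 x3 y1 y2 y3, ~ triangle_in E x1 x2 x3 y1 y2 y3.

Lemma link_card2 (V : finType) (E : {set {set V}}) (x : V) (l : {set V}) :
  uniform3 E -> l \in link E x -> #|l| = 2.
Proof.
move=> uE; rewrite inE => /andP[xl /(uniform3_card uE)].
by rewrite cardsU1 xl add1n => -[].
Qed.

(** Let [l = u z] with [u] in [g] and [z] outside, and [l' = p q]. If [g] avoids
    [l'], then [g], [x u z], [x p q] form a path. If [g] contains exactly one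
    of [p] and [q], they form a triangle, with [x] and [u] among its corners. *)
Lemma link_rigid (V : finType) (E : {set {set V}}) (x : V) :
  uniform3 E -> path_free E -> triangle_free E ->
  crossing_rigid (link E x) [set g in E | x \notin g].
Proof.
move=> uE pE tE g l l'; rewrite inE => /andP[gE xg] lL l'L.
case/pred0Pn=> u /andP[/= ul ug] /subsetPn[z zl zg] dis.
have g3 := uniform3_card uE gE.
have uz : u != z := mem_notin_neq ug zg.
have [y yu eq_l] := card2_split (link_card2 uE lL) ul.
have yz : y = z by move: zl; rewrite eq_l !inE eq_sym (negbTE uz) /= => /eqP.
subst y; subst l.
have /cards2P[p [q [pq eq_l']]] : #|l'| == 2 by rewrite (link_card2 uE l'L).
move: lL l'L; rewrite !inE eq_l' !inE !negb_or.
case/andP=> /andP[xu xz] xuzE /andP[/andP[xp xq] xpqE].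
have out t : t \in [set p; q] -> (t != u) && (t != z).
  by rewrite -eq_l' => tl'; move: (disjointFl dis tl'); rewrite !inE => /negbT; rewrite negb_or.
have /andP[pu pz] : (p != u) && (p != z) by apply: out; rewrite !inE eqxx.
have /andP[qu qz] : (q != u) && (q != z) by apply: out; rewrite !inE eqxx orbT.
have corner a b : a != b -> x != a -> x != b -> a != u -> a != z -> b != u -> b != z ->
    x |: [set a; b] \in E -> a \in g -> b \notin g -> False.
  move=> ab xa xb au az bu bz xabE ag bg.
  have [s [t [eq_g us ut st]]] := card3_split g3 ug.
  have [c [cg ca cu]] : exists c, [/\ c \in g, c != a & c != u].
    move: ag; rewrite eq_g !inE (negbTE au) /= => /orP[] /eqP->.
      by exists t; rewrite !inE eqxx orbT !(eq_sym t).
    by exists s; rewrite !inE eqxx orbT (eq_sym s u).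
  apply: (tE x u a c b z); split; first by distinct.
  - by rewrite -(card3_eq g3 ug cg ag) //; neq.
  - by have -> : [set a; b; x] = x |: [set a; b] by seteq.
  by have -> : [set x; z; u] = x |: [set u; z] by seteq.
case: (boolP (p \in g)) => pg; case: (boolP (q \in g)) => qg.
- apply/eqP; rewrite eqEcard subUset !sub1set !inE !negb_or pu pz pg qu qz qg /=.
  rewrite cards2 pq cardsD g3.
  have -> : g :&: [set u; z] = [set u].
    by apply/setP => t; rewrite !inE; case: eqP => [->|_]; rewrite ?ug ?andbF //=;
       case: eqP => [->|_]; rewrite ?(negbTE zg) ?andbF.
  by rewrite cards1.
- by case: (corner p q).
- by case: (corner q p) => //; [rewrite eq_sym | rewrite (setUC [set q])].
case: (@no_pendant _ E g u z x p q) => //; first by distinct.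
- by have -> : [set u; z; x] = x |: [set u; z] by seteq.
by rewrite -setUA.
Qed.

(** * The Turan number of the path *)

(** The average degree is at least [3 m (m - 1) / (2 (m + 1))], which exceeds [m]
    for [m > 5]. *)
Lemma large_degree (V : finType) (E : {set {set V}}) (S : {set V}) (m : nat) :
  uniform3 E -> (forall e, e \in E -> e \subset S) -> #|S| = m.+1 -> 6 < m ->
  'C(m, 2) <= #|E| -> exists2 x, x \in S & m < #|link E x|.
Proof.
move=> uE ES Sm m7 big; apply/exists_inP; apply: contraLR big => /exists_inPn small.
have sum3 : \sum_(x in S) #|[set e in E | x \in e]| = 3 * #|E|.
  by apply: degree_sum => e eE; rewrite (uniform3_card uE eE) ES.
have : 3 * #|E| <= m.+1 * m.
  rewrite -sum3 -Sm -sum_nat_const; apply: leq_sum => x /small.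
  by rewrite card_link -leqNgt.
have : m * 6 <= m * m.-1 by rewrite leq_mul2l -ltnS (ltn_predK m7) m7 orbT.
have : m.+1 * m = m * m.-1 + 2 * m by clear -m7; case: m m7 => // m _ /=; lia.
have := bin2_mul2 m; rewrite -ltnNge.
by move: (_ * m) (m * m.-1) 'C(m, 2) #|E|; clear -m7; lia.
Qed.

Lemma triangle_free_star (V : finType) (E : {set {set V}}) (S : {set V}) (m : nat) :
  uniform3 E -> path_free E -> triangle_free E ->
  (forall e, e \in E -> e \subset S) -> #|S| = m.+1 -> 6 < m ->
  (forall T : {set V}, #|T| <= m -> #|spanned E T| <= turan_bound #|T|) ->
  'C(m, 2) <= #|E| -> exists2 x, x \in S & forall e, e \in E -> x \in e.
Proof.
move=> uE pE tE ES Sm m7 IH big.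
have [x xS deg] := large_degree uE ES Sm m7 big; exists x => // g0 g0E.
apply: contraLR big => xg0; rewrite -ltnNge.
pose N := S :\ x; pose L := link E x; pose G := [set g in E | x \notin g].
have Nm : #|N| = m by have := cardsD1 x S; rewrite xS Sm add1n => -[].
have LN l : l \in L -> l \subset N /\ #|l| = 2.
  move=> lL; split; last exact: link_card2 lL.
  move: lL; rewrite inE => /andP[xl /ES]; rewrite subUset subsetD1 => /andP[_ ->].
  exact: xl.
have GN g : g \in G -> g \subset N /\ #|g| = 3.
  rewrite inE => /andP[gE xg]; split; last exact: uniform3_card gE.
  by rewrite subsetD1 ES.
have rigid : crossing_rigid L G := link_rigid uE pE tE.
have -> : #|E| = #|L| + #|G|.
  rewrite card_link -(cardsID [set e : {set V} | x \in e] E); congr (_ + _).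
  - by apply: eq_card => e; rewrite !inE andbC.
  - by apply: eq_card => e; rewrite !inE andbC.
case: (boolP [exists g in G, exists l in L, ~~ [disjoint l & g] && ~~ (l \subset g)]).
  case/exists_inP=> g gG /exists_inP[l lL /andP[meet out]].
  by rewrite -Nm; apply: crossing_small gG lL meet out => //; rewrite Nm.
move=> nocross.
have inside g l : g \in G -> l \in L -> ~~ [disjoint l & g] -> l \subset g.
  move=> gG lL meet; apply: contraR nocross => out.
  by apply/exists_inP; exists g => //; apply/exists_inP; exists l; rewrite ?meet.
have coverN : cover G \subset N by apply/bigcupsP => g /GN[].
have g0G : g0 \in G by rewrite inE g0E.
apply: (@noncrossing_arith m #|cover G|) => //.
- by rewrite -(GN g0 g0G).2; apply/subset_leq_card/(bigcup_sup g0).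
- by rewrite -Nm subset_leq_card.
- have := noncrossing_le LN (fun g gG => (GN g gG).2) inside.
  by rewrite cardsD (setIidPr coverN) Nm.
apply: leq_trans (IH (cover G) _); last by rewrite -Nm subset_leq_card.
apply/subset_leq_card/subsetP => g gG; rewrite inE.
by rewrite (bigcup_sup g) // andbT; move: gG; rewrite inE => /andP[].
Qed.

Lemma triangle_dec (V : finType) (E : {set {set V}}) :
  (exists x1 x2 x3 y1 y2 y3, triangle_in E x1 x2 x3 y1 y2 y3) \/ triangle_free E.
Proof.
pose tri x1 x2 x3 y1 y2 y3 := [&& uniq [:: x1; x2; x3; y1; y2; y3],
  [set x2; y1; x3] \in E, [set x3; y2; x1] \in E & [set x1; y3; x2] \in E].
case: (boolP [exists x1, exists x2, exists x3, exists y1, exists y2, exists y3,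
              tri x1 x2 x3 y1 y2 y3]) => found; [left | right].
  case/existsP: found => x1 /existsP[x2 /existsP[x3 /existsP[y1 /existsP[y2 /existsP[y3]]]]].
  by case/and4P=> *; exists x1, x2, x3, y1, y2, y3.
move=> x1 x2 x3 y1 y2 y3 [U E1 E2 E3]; case/negP: found.
apply/existsP; exists x1; apply/existsP; exists x2; apply/existsP; exists x3.
apply/existsP; exists y1; apply/existsP; exists y2; apply/existsP; exists y3.
exact/and4P.
Qed.

Lemma sub_uniform3 (V : finType) (E E' : {set {set V}}) :
  E' \subset E -> uniform3 E -> uniform3 E'.
Proof. by move=> /subsetP sE /forall_inP uE; apply/forall_inP => e /sE/uE. Qed.

Lemma sub_path_free (V : finType) (E E' : {set {set V}}) :
  E' \subset E -> path_free E -> path_free E'.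
Proof.
move=> /subsetP sE pE a b c d e f g U /sE E1 /sE E2 /sE E3; exact: pE U E1 E2 E3.
Qed.

Lemma spanned_sub (V : finType) (E : {set {set V}}) S : spanned E S \subset E.
Proof. by apply/subsetP => e; rewrite inE => /andP[]. Qed.

Lemma star_le (V : finType) (E : {set {set V}}) (S : {set V}) (x : V) :
  uniform3 E -> (forall e, e \in E -> e \subset S) -> (forall e, e \in E -> x \in e) ->
  #|E| <= 'C(#|S :\ x|, 2).
Proof.
move=> uE ES Ex; have -> : #|E| = #|link E x|.
  by rewrite card_link; apply: eq_card => e; rewrite inE; case: (boolP (e \in E)) => // /Ex ->.
rewrite -cards_draws; apply/subset_leq_card/subsetP => l lL.
rewrite inE (link_card2 uE lL) eqxx andbT subsetD1.
move: lL; rewrite inE => /andP[-> /ES]; by rewrite subUset => /andP[_ ->].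
Qed.

(** The decomposition of a path-free 3-graph on [6 + k + q >= 8] vertices that
    contains a triangle stays below the size of a full star. For 8 vertices
    the two sides are 20 and 21. *)
Lemma triangle_arith k q : 1 < k + q ->
  triangle_bound k + turan_bound q < 'C(5 + k + q, 2).
Proof.
move=> kq; have tq : turan_bound q <= 'C(q, 2) + 5 * q.
  rewrite /turan_bound; case: (leqP q 7) => q7.
    by clear -q7; case: q q7 => [|[|[|[|[|[|[|[|q]]]]]]]].
  by apply: leq_trans (leq_addr _ _); rewrite leq_bin2l // leq_pred.
rewrite /triangle_bound; case: (leqP k 1) => k1.
  case: (leqP q 7) => q7.
    rewrite /turan_bound q7; clear -q7 kq k1.
    by case: k k1 kq => [|[|k]] //; case: q q7 => [|[|[|[|[|[|[|[|q]]]]]]]].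
  rewrite bin2D; have : turan_bound q <= 'C(q, 2).
    by rewrite /turan_bound (leqNgt q 7) q7 /= leq_bin2l // leq_pred.
  have : 10 <= 'C(5 + k, 2) by rewrite -[10]/('C(5, 2)) leq_bin2l // leq_addr.
  have : 5 * 8 <= (5 + k) * q by rewrite leq_mul // leq_addr.
  by move: 'C(q, 2) 'C(5 + k, 2) (turan_bound q) (_ * q); clear; lia.
rewrite !bin2D; have -> : 'C(5, 2) = 10 by [].
have : 1 <= 'C(k, 2) by rewrite bin_gt0.
have : 5 * q <= (5 + k) * q by rewrite leq_mul // leq_addr.
by move: tq; move: 'C(q, 2) 'C(k, 2) (turan_bound q) ((5 + k) * q); clear -k1; lia.
Qed.

Lemma core_subset (V : finType) (E : {set {set V}}) (S : {set V})
    (x1 x2 x3 y1 y2 y3 : V) :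
  (forall e, e \in E -> e \subset S) -> triangle_in E x1 x2 x3 y1 y2 y3 ->
  core x1 x2 x3 y1 y2 y3 \subset S.
Proof.
move=> ES [_ /ES E1 /ES E2 /ES E3]; apply/subsetP => z.
move: E1 E2 E3; rewrite !subUset !sub1set => /andP[/andP[a b] c] /andP[/andP[d e] f].
by case/andP=> /andP[g h] i; rewrite !inE => /or4P[||| /or3P[]] /eqP->.
Qed.

Lemma turan_bound_of_dichotomy (V : finType) (E : {set {set V}}) (S : {set V}) :
  uniform3 E ->
  (7 < #|S| -> (exists2 x, x \in S & forall e, e \in spanned E S -> x \in e)
               \/ #|spanned E S| < 'C(#|S|.-1, 2)) ->
  #|spanned E S| <= turan_bound #|S|.
Proof.
move=> uE dich; rewrite /turan_bound; case: (leqP #|S| 7) => S7.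
  exact: spanned_le.
case: (dich S7) => [[x xS star]|/ltnW //].
have -> : #|S|.-1 = #|S :\ x| by rewrite (cardsD1 x S) xS.
apply: star_le star => [|e]; last by rewrite inE => /andP[].
exact: sub_uniform3 (spanned_sub E S) uE.
Qed.

(** The Turan number of the path, with stability in the weak form that any 3-graph
    attaining it is a star. It is stated for the part spanned by [S] so that the
    induction can pass to subsets of a fixed vertex type. *)
Theorem path_free_star_or_small (V : finType) (E : {set {set V}}) (S : {set V}) :
  uniform3 E -> path_free E -> 7 < #|S| ->
  (exists2 x, x \in S & forall e, e \in spanned E S -> x \in e)
  \/ #|spanned E S| < 'C(#|S|.-1, 2).
Proof.
move=> uE pE; have [n] := ubnP #|S|; elim: n S => // n IHn S ltS S7.
have IH (T : {set V}) : #|T| < #|S| -> #|spanned E T| <= turan_bound #|T|.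
  move=> ltT; apply: turan_bound_of_dichotomy => //; apply: IHn.
  by move: ltT ltS; clear; lia.
pose F := spanned E S.
have uF : uniform3 F := sub_uniform3 (spanned_sub E S) uE.
have pF : path_free F := sub_path_free (spanned_sub E S) pE.
have FS e : e \in F -> e \subset S by rewrite inE => /andP[].
have FT (T : {set V}) : #|spanned F T| <= #|spanned E T|.
  apply/subset_leq_card/subsetP => e; rewrite !inE => /andP[/andP[-> _] ->].
  by [].
have [[x1 [x2 [x3 [y1 [y2 [y3 tF]]]]]]|tF] := triangle_dec F; [right|].
  have [W [WS posW zeroW]] := triangle_decomposition uF pF FS tF.
  have US := core_subset FS tF; have [uU _ _ _] := tF; have U6 := card_core uU.
  move: WS posW zeroW US U6; set U := core _ _ _ _ _ _ => WS posW zeroW US U6.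
  have cU : #|S :\: U| = #|S| - 6 by rewrite cardsD (setIidPr US) U6.
  have cW : #|S :\: U :\: W| = #|S| - 6 - #|W| by rewrite cardsD (setIidPr WS) cU.
  have S6 : 6 <= #|S| by rewrite -U6 subset_leq_card.
  have W6 : #|W| <= #|S| - 6 by rewrite -cU subset_leq_card.
  have eqS : #|S| = 6 + #|W| + #|S :\: U :\: W|.
    by rewrite cW; move: S6 W6; move: #|S| #|W|; clear; lia.
  have R_lt : #|S :\: U :\: W| < #|S| by move: eqS; move: #|S| #|_ :\: W| #|W|; clear; lia.
  have le : #|F| <= triangle_bound #|W| + turan_bound #|S :\: U :\: W|.
    apply: leq_trans (leq_add (leqnn _) (leq_trans (FT _) (IH _ R_lt))).
    case: (posnP #|W|) => [W0|]; last exact: posW.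
    apply: leq_trans (zeroW W0) _; have -> : W = set0 by apply: cards0_eq.
    by rewrite setD0 cards0 leq_add2r; have := spanned_le U uF; rewrite U6.
  apply: leq_ltn_trans le _.
  have := triangle_arith (k := #|W|) (q := #|S :\: U :\: W|).
  have -> : 5 + #|W| + #|S :\: U :\: W| = #|S|.-1 by rewrite eqS.
  by apply; move: S7; rewrite eqS -addnA -[8]/(6 + 2) leq_add2l.
case: (ltnP #|F| 'C(#|S|.-1, 2)) => [|big]; [by right | left].
have Sm : #|S| = #|S|.-1.+1 by rewrite (ltn_predK S7).
apply: (triangle_free_star uF pF tF FS Sm) => // [|T]; first by rewrite -ltnS -Sm.
by rewrite -ltnS -Sm => ltT; apply: leq_trans (FT T) (IH T ltT).
Qed.

(** * The extremal 3-graphs containing a triangle *)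

(** An isolated eighth vertex brings the theorem for 8 vertices into play: fewer
    than [C(7,2) = 21] edges, unless all edges share a vertex of [S], in
    which case there are at most [C(6,2) = 15]. *)
Lemma seven_vertices_le20 (V : finType) (E : {set {set V}}) (S : {set V}) :
  uniform3 E -> path_free E -> #|S| = 7 -> 7 < #|V| -> #|spanned E S| <= 20.
Proof.
move=> uE pE S7 V7; have /card_gt0P[v] : 0 < #|~: S|.
  by rewrite cardsCs setCK S7 subn_gt0.
rewrite inE => vS; pose F := spanned E S.
have uF : uniform3 F := sub_uniform3 (spanned_sub E S) uE.
have pF : path_free F := sub_path_free (spanned_sub E S) pE.
have cS : #|v |: S| = 8 by rewrite cardsU1 vS S7.
have FE : spanned F (v |: S) = F.
  apply/setP => e; rewrite !inE; case: (boolP (e \subset S)) => [eS|]; last by rewrite andbF.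
  by rewrite (subset_trans eS (subsetUr _ _)) !andbT.
have := path_free_star_or_small (S := v |: S) uF pF; rewrite cS FE => /(_ isT).
case=> [[x _ star]|]; last by rewrite -ltnS.
case: (set_0Vmem F) => [F0|[e eF]]; first by rewrite -/F F0 cards0.
have xS : x \in S by move: (eF); rewrite inE => /andP[_ /subsetP]; apply; apply: star.
have FS f : f \in F -> f \subset S by rewrite inE => /andP[].
apply: leq_trans (star_le uF FS star) _.
have : #|S| = 7 := S7; rewrite (cardsD1 x) xS add1n => -[->]; by [].
Qed.

(** The inequality is tight up to one for [k = 1], [q = 7] and for [k = 2],
    [q = 6]; the former needs the sharp bound on seven vertices. *)
Lemma extremal_arith k q b : 0 < k -> 7 < k + q -> b <= turan_bound q ->
  (q = 7 -> b <= 20) -> triangle_bound k + b < 20 + 'C(k + q - 1, 2).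
Proof.
move=> k0 kq le_b le_b7; rewrite /triangle_bound.
case: (leqP q 7) => q7; last first.
  have {}le_b : b <= 'C(q.-1, 2) by move: le_b; rewrite /turan_bound (leqNgt q 7) q7.
  have -> : k + q - 1 = q.-1 + k by move: k0 q7; clear; lia.
  rewrite bin2D; have : 7 * k <= q.-1 * k by rewrite leq_mul // -ltnS (ltn_predK q7).
  by move: le_b; move: 'C(q.-1, 2) 'C(k, 2) (q.-1 * k); clear -k0; case: (leqP k 1); lia.
(* For [q <= 7], count from the smallest case [k + q = 8]. *)
have [j [kE jE ->]] : exists j, [/\ k + q = j + 8, k = j + 8 - q & k + q - 1 = 7 + j].
  by exists (k + q - 8); split; move: kq q7; clear; lia.
rewrite bin2D; have -> : 'C(7, 2) = 21 by [].
have {}le_b : b <= nth 0 [:: 0; 0; 0; 1; 4; 10; 20; 20] q.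
  case: (eqVneq q 7) => [q_eq|q7']; first by rewrite q_eq le_b7.
  by move: le_b; clear -q7 q7'; case: q q7 q7' => [|[|[|[|[|[|[|[|]]]]]]]].
move: le_b; move: 'C(j, 2) => c; clear -k0 q7 kE jE.
by case: q q7 kE jE => [|[|[|[|[|[|[|[|q]]]]]]]] //= _ kE jE le_b; case: (leqP k 1); lia.
Qed.

(** An attached vertex makes the inequality strict by [extremal_arith]. Without
    any, equality forces both parts of the decomposition to be maximal: all
    triples of [U], and a full star on the other vertices. *)
Lemma triangle_extremal (V : finType) (E : {set {set V}}) (x1 x2 x3 y1 y2 y3 : V) :
  uniform3 E -> path_free E -> 14 <= #|V| -> triangle_in E x1 x2 x3 y1 y2 y3 ->
  #|E| <= 20 + 'C(#|V| - 7, 2) /\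
  (#|E| = 20 + 'C(#|V| - 7, 2) -> exists (U : {set V}) (x : V),
    [/\ #|U| = 6, x \notin U & forall e : {set V}, #|e| = 3 ->
      (e \subset U -> e \in E) /\ (x \in e -> [disjoint e & U] -> e \in E)]).
Proof.
move=> uE pE V14 tE.
have ET e : e \in E -> e \subset [set: V] by rewrite subsetT.
have [W [WU posW zeroW]] := triangle_decomposition uE pE ET tE.
have [uU _ _ _] := tE; have U6 := card_core uU.
move: WU posW zeroW U6; rewrite setTD; set U := core _ _ _ _ _ _ => WU posW zeroW U6.
have cU : #|~: U| = #|V| - 6 by rewrite cardsCs setCK U6.
have cWR : #|W| + #|~: U :\: W| = #|V| - 6.
  by rewrite -cU -[in RHS](cardsID W) (setIidPr WU).
have dich S := @path_free_star_or_small _ E S uE pE.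
case: (posnP #|W|) => [W0|Wpos].
  have le20 : #|spanned E U| <= 20 by have := spanned_le U uE; rewrite U6.
  have R8 : 7 < #|~: U| by rewrite cU; move: V14; clear; lia.
  have n7 : #|~: U|.-1 = #|V| - 7 by rewrite cU; move: V14; clear; lia.
  have leR : #|spanned E (~: U)| <= 'C(#|V| - 7, 2).
    by have := turan_bound_of_dichotomy uE (dich (~: U));
      rewrite /turan_bound (leqNgt #|~: U|) R8 n7.
  have leE := zeroW W0; split=> [|eqE]; first exact: leq_trans leE (leq_add le20 leR).
  have eqR : #|spanned E (~: U)| = 'C(#|V| - 7, 2).
    apply/eqP; rewrite eqn_leq leR -(leq_add2l 20) -eqE.
    by apply: leq_trans leE _; rewrite leq_add2r.
  have eq20 : #|spanned E U| = 20.
    apply/eqP; rewrite eqn_leq le20 -(leq_add2r 'C(#|V| - 7, 2)) -eqE.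
    by apply: leq_trans leE _; rewrite leq_add2l.
  have [[x xR star]|] := dich _ R8; last by rewrite n7 eqR ltnn.
  exists U, x; split=> [//||e e3]; first by move: xR; rewrite inE.
  split=> [eU|xe eR].
    have eqU : spanned E U = [set e : {set V} | e \subset U & #|e| == 3].
      apply/eqP; rewrite eqEcard cards_draws U6 eq20 leqnn andbT.
      apply/subsetP => f; rewrite !inE => /andP[fE ->].
      by rewrite (uniform3_card uE fE).
    suff : e \in spanned E U by rewrite inE => /andP[].
    by rewrite eqU inE eU e3.
  pose P := [set e : {set V} | [&& #|e| == 3, x \in e & e \subset ~: U]].
  have eqP' : spanned E (~: U) = P.
    apply/eqP; rewrite eqEcard eqR; apply/andP; split.
      apply/subsetP => f fR; move: (fR); rewrite !inE star // => /andP[fE ->].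
      by rewrite (uniform3_card uE fE).
    rewrite -n7; have -> : #|~: U|.-1 = #|~: U :\ x| by rewrite (cardsD1 x (~: U)) xR.
    apply: star_le => [|f|f]; last 2 first.
    - by rewrite inE => /and3P[].
    - by rewrite inE => /and3P[].
    by apply/forall_inP => f; rewrite inE => /and3P[].
  suff : e \in spanned E (~: U) by rewrite inE => /andP[].
  by rewrite eqP' inE e3 xe -disjoints_subset.
have : #|E| < 20 + 'C(#|V| - 7, 2).
  apply: leq_ltn_trans (posW Wpos) _.
  have -> : #|V| - 7 = #|W| + #|~: U :\: W| - 1.
    by rewrite cWR; move: V14; clear; lia.
  apply: extremal_arith => //; first by rewrite cWR; move: V14; clear; lia.
  - exact: turan_bound_of_dichotomy (dich _).
  by move=> R7; apply: seven_vertices_le20 => //; apply: leq_trans V14.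
by move=> lt; split=> [|eqE]; [exact: ltnW | move: lt; rewrite eqE ltnn].
Qed.

(** * Containment and isomorphism *)

Lemma imset_triple (n : nat) (V : finType) (f : 'I_n -> V) (i j k : 'I_n) :
  f @: triple n i j k = [set f i; f j; f k].
Proof.
have -> : triple n i j k = [set i; j; k].
  by apply/setP => z; rewrite !inE !val_eqE orbA.
by rewrite !imsetU !imset_set1.
Qed.

Lemma free_path (V : finType) (H : graph3 V) :
  free P33 H <-> path_free (edges H).
Proof.
pose o k (lt : k < 7) : 'I_7 := Ordinal lt.
have tripleE (f : 'I_7 -> V) i j k (li : i < 7) (lj : j < 7) (lk : k < 7) :
    f @: triple 7 i j k = [set f (o i li); f (o j lj); f (o k lk)].
  exact: (imset_triple f (o i li) (o j lj) (o k lk)).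
split=> [fH a b c d e f g U E1 E2 E3 | pH].
  case/negP: fH; apply/containsP.
  exists (fun i : 'I_7 => nth a [:: a; b; c; d; e; f; g] i).
    by move=> i j /eqP; rewrite nth_uniq // => /eqP/val_inj.
  move=> s; rewrite !inE => /orP[/orP[]|] /eqP->.
  - by rewrite (tripleE _ 0 1 2 isT isT isT).
  - by rewrite (tripleE _ 2 3 4 isT isT isT).
  - by rewrite (tripleE _ 4 5 6 isT isT isT).
apply/negP => /containsP[f injf fE].
apply: (pH (f (o 0 isT)) (f (o 1 isT)) (f (o 2 isT)) (f (o 3 isT)) (f (o 4 isT))
           (f (o 5 isT)) (f (o 6 isT))).
- by rewrite -[X in uniq X]/(map f [:: o 0 isT; o 1 isT; o 2 isT; o 3 isT;
    o 4 isT; o 5 isT; o 6 isT]) map_inj_uniq.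
- by rewrite -(tripleE f 0 1 2) fE // !inE eqxx.
- by rewrite -(tripleE f 2 3 4) fE // !inE eqxx orbT.
- by rewrite -(tripleE f 4 5 6) fE // !inE eqxx !orbT.
Qed.

Lemma contains_triangle (V : finType) (H : graph3 V) :
  contains C33 H ->
  exists x1 x2 x3 y1 y2 y3, triangle_in (edges H) x1 x2 x3 y1 y2 y3.
Proof.
pose o k (lt : k < 6) : 'I_6 := Ordinal lt.
have tripleE (f : 'I_6 -> V) i j k (li : i < 6) (lj : j < 6) (lk : k < 6) :
    f @: triple 6 i j k = [set f (o i li); f (o j lj); f (o k lk)].
  exact: (imset_triple f (o i li) (o j lj) (o k lk)).
case/containsP => f injf fE.
exists (f (o 0 isT)), (f (o 2 isT)), (f (o 4 isT)).
exists (f (o 3 isT)), (f (o 5 isT)), (f (o 1 isT)); split.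
- by rewrite -[X in uniq X]/(map f [:: o 0 isT; o 2 isT; o 4 isT; o 3 isT;
    o 5 isT; o 1 isT]) map_inj_uniq.
- by rewrite -(tripleE f 2 3 4) fE // !inE eqxx orbT.
- by rewrite -(tripleE f 4 5 0) fE // !inE eqxx !orbT.
- by rewrite -(tripleE f 0 1 2) fE // !inE eqxx.
Qed.

Lemma isomorphic_sym (U V : finType) (G : graph3 U) (H : graph3 V) :
  isomorphic G H -> isomorphic H G.
Proof.
case=> f [g gf fg] fE; exists g; first by exists f.
move=> e; rewrite -fE -imset_comp (eq_imset (g := id)) ?imset_id //.
Qed.

Lemma isomorphic_contains (W U V : finType) (F : graph3 W) (G : graph3 U)
    (H : graph3 V) :
  isomorphic G H -> contains F G -> contains F H.
Proof.
case=> f /bij_inj injf fE /containsP[h injh hE]; apply/containsP.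
exists (f \o h); first exact: inj_comp.
by move=> e eF; rewrite imset_comp fE hE.
Qed.

Lemma isomorphic_card (U V : finType) (G : graph3 U) (H : graph3 V) :
  isomorphic G H -> #|edges G| = #|edges H|.
Proof.
case=> f bijf fE; have [g gf fg] := bijf.
rewrite -(card_imset _ (imset_inj (bij_inj bijf))); apply: eq_card => e.
apply/imsetP/idP => [[e' e'G ->]|eH]; first by rewrite fE.
have eE : e = f @: (g @: e) by rewrite -imset_comp (eq_imset (g := id)) ?imset_id.
by exists (g @: e) => //; rewrite -fE -eE.
Qed.

(** An injective homomorphism between 3-graphs of equal order and size cannot miss
    an edge. *)
Lemma isomorphic_of_embedding (U V : finType) (G : graph3 U) (H : graph3 V)
    (f : U -> V) :
  injective f -> #|U| = #|V| -> (forall e, e \in edges G -> f @: e \in edges H) ->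
  #|edges G| = #|edges H| -> isomorphic G H.
Proof.
move=> injf cUV fE cE; exists f; first by apply: inj_card_bij; rewrite ?cUV.
have <- : (fun e : {set U} => f @: e) @: edges G = edges H.
  apply/eqP; rewrite eqEcard (card_imset _ (imset_inj injf)) cE leqnn andbT.
  by apply/subsetP => _ /imsetP[e eG ->]; apply: fE.
by move=> e; rewrite mem_imset //; apply: imset_inj.
Qed.

Lemma isomorphic_copy (U V : finType) (G : graph3 U) : #|U| = #|V| ->
  exists H : graph3 V, isomorphic G H.
Proof.
move=> cUV; pose f (u : U) : V := enum_val (cast_ord cUV (enum_rank u)).
have injf : injective f by move=> u v /enum_val_inj/cast_ord_inj/enum_rank_inj.
have uH : uniform3 ((fun e : {set U} => f @: e) @: edges G).
  apply/forall_inP => _ /imsetP[e eG ->]; rewrite card_imset //.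
  by rewrite (uniform3_card (edges_uniform3 G) eG).
exists (Graph3 uH); apply: (isomorphic_of_embedding injf cUV) => /=.
  by move=> e eG; apply: imset_f.
by rewrite card_imset //; apply: imset_inj.
Qed.

(** * The disjoint union of a complete 3-graph and a star *)

Lemma card_star_edges (m : nat) : 0 < m -> #|edges (S3 m)| = 'C(m.-1, 2).
Proof.
case: m => // m _; rewrite [m.+1.-1]/=.
have cN : #|[set: 'I_m.+1] :\ ord0| = m.
  by have := cardsD1 ord0 [set: 'I_m.+1]; rewrite inE cardsT card_ord add1n => -[].
have centre (e : {set 'I_m.+1}) : (e \in edges (S3 m.+1)) = (#|e| == 3) && (ord0 \in e).
  rewrite inE; congr andb; apply/exists_inP/idP => [[v ve /eqP v0]|]; last by exists ord0.
  by rewrite (_ : ord0 = v) //; apply: val_inj.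
have -> : #|edges (S3 m.+1)| = #|link (edges (S3 m.+1)) ord0|.
  rewrite card_link; apply: eq_card => e; rewrite [RHS]inE centre.
  by case: (ord0 \in e); rewrite ?andbF ?andbT.
rewrite -[in RHS]cN -cards_draws; apply: eq_card => l; rewrite [LHS]inE centre [RHS]inE.
rewrite subsetD1 subsetT setU11 andbT /= cardsU1.
by case: (boolP (ord0 \in l)).
Qed.

(** Consecutive edges of a path share a vertex, so a path would lie in one of the
    two parts: the first has only 6 vertices, and in the second all edges share
    a vertex, while the end edges of a path are disjoint. *)
Lemma K6_star_free (m : nat) : free P33 (dunion (K3 6) (S3 m)).
Proof.
apply/free_path => a b c d e f g U E1 E2 E3.
pose L := [set (inl i : 'I_6 + 'I_m) | i in 'I_6].
have side (x y z : 'I_6 + 'I_m) : [set x; y; z] \in edges (dunion (K3 6) (S3 m)) ->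
    [/\ x \in L, y \in L & z \in L] \/
    [/\ x \notin L, z \notin L &
        exists2 v : 'I_m, val v = 0 & inr v \in [set x; y; z]].
  have [xe ye ze] : [/\ x \in [set x; y; z], y \in [set x; y; z] & z \in [set x; y; z]].
    by rewrite !inE !eqxx !orbT.
  rewrite inE => /orP[] /imsetP[t tE eq_t]; move: xe ye ze; rewrite eq_t.
    by move=> /imsetP[i _ ->] /imsetP[j _ ->] /imsetP[k _ ->]; left; rewrite !imset_f.
  move: tE; rewrite inE => /andP[_ /exists_inP[v vt /eqP v0]].
  have out j : inr j \notin L by apply/imsetP => -[].
  move=> /imsetP[i _ ->] _ /imsetP[k _ ->]; right; rewrite !out; split=> //.
  by exists v => //; apply: imset_f.
case: (side _ _ _ E1) => [[aL bL cL]|[_ cL [v v0 v1]]].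
  case: (side _ _ _ E2) => [[_ dL eL]|[]]; last by rewrite cL.
  case: (side _ _ _ E3) => [[_ fL gL]|[]]; last by rewrite eL.
  have := count_mem_card L U; rewrite /= aL bL cL dL eL fL gL.
  by rewrite card_imset ?card_ord // => ? ? [].
case: (side _ _ _ E2) => [[]|[_ eL _]]; first by rewrite (negbTE cL).
case: (side _ _ _ E3) => [[]|[_ _ [w w0]]]; first by rewrite (negbTE eL).
have -> : w = v by apply: val_inj; rewrite w0 v0.
move: v1 U; rewrite !inE => /orP[/orP[]|] /eqP<- U1 /orP[/orP[]|] /eqP eq_v; move: U1;
  by rewrite eq_v /= !inE !eqxx ?orbT ?andbF.
Qed.

Lemma card_K6_star (m : nat) : 0 < m ->
  #|edges (dunion (K3 6) (S3 m))| = 20 + 'C(m.-1, 2).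
Proof.
move=> m0; rewrite /= cardsU disjoint_setI0 ?cards0 ?subn0; last first.
  apply/pred0P => e; apply/negP => /andP[/= /imsetP[s]]; rewrite inE => /eqP s3 ->.
  case/imsetP=> t _ eq_st; have /card_gt0P[i iS] : 0 < #|s| by rewrite s3.
  have : inl i \in [set (inr y : 'I_6 + 'I_m) | y in t] by rewrite -eq_st imset_f.
  by case/imsetP.
rewrite !card_imset; last 2 first.
- by apply: imset_inj => ? ? [].
- by apply: imset_inj => ? ? [].
by rewrite -(card_star_edges m0) /complete_edges card_draws card_ord.
Qed.

Lemma K6_star_contains (m : nat) : contains C33 (dunion (K3 6) (S3 m)).
Proof.
apply/containsP; exists inl => [i j []//|e eC]; rewrite /= inE; apply/orP; left.
apply: imset_f; rewrite inE; exact: (forall_inP triangle_uniform3).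
Qed.

Lemma list_embedding (V : finType) (s : seq V) (k : nat) (x : V) : uniq s -> size s = k ->
  injective (fun i : 'I_k => nth x s i).
Proof.
by move=> us sk i j /eqP; rewrite nth_uniq ?sk // => /eqP/val_inj.
Qed.

(** List the vertices of [U], and those outside [U] starting with [x]: the image of
    the vertex 0 of the star must be its centre [x]. *)
Lemma extremal_isomorphic (V : finType) (H : graph3 V) (U : {set V}) (x : V) (m : nat) :
  #|V| = 6 + m -> #|edges H| = 20 + 'C(m.-1, 2) -> #|U| = 6 -> x \notin U ->
  (forall e : {set V}, #|e| = 3 -> (e \subset U -> e \in edges H) /\
     (x \in e -> [disjoint e & U] -> e \in edges H)) ->
  isomorphic H (dunion (K3 6) (S3 m)).
Proof.
move=> cV cE U6 xU full.
pose s := x :: enum (~: U :\ x).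
have us : uniq s by rewrite /= enum_uniq mem_enum !inE eqxx.
have cR : #|~: U| = m by rewrite cardsCs setCK U6 cV addKn.
have ss : size s = m by rewrite /= -cardE -cR (cardsD1 x (~: U)) inE xU.
have sU i : i < m -> nth x s i \notin U.
  move=> im; have : nth x s i \in s by rewrite mem_nth ?ss.
  rewrite inE => /orP[/eqP->//|]; rewrite mem_enum !inE => /andP[_ ->]; exact: isT.
have uU : uniq (enum U) := enum_uniq _.
have sizeU : size (enum U) = 6 by rewrite -cardE.
have enumU i : i < 6 -> nth x (enum U) i \in U.
  by move=> i6; rewrite -mem_enum mem_nth ?sizeU.
pose f (v : 'I_6 + 'I_m) : V :=
  match v with inl i => nth x (enum U) i | inr j => nth x s j end.
have injl := list_embedding (x := x) uU sizeU.
have injr := list_embedding (x := x) us ss.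
have injf : injective f.
  case=> [i|i] [j|j] //=.
  - by move/injl->.
  - by move=> eq_ij; have := enumU i (ltn_ord i); rewrite eq_ij (negbTE (sU j (ltn_ord j))).
  - by move=> eq_ij; have := enumU j (ltn_ord j); rewrite -eq_ij (negbTE (sU i (ltn_ord i))).
  - by move/injr->.
have m0 : 0 < m by rewrite -ss.
apply: isomorphic_sym; apply: (isomorphic_of_embedding injf).
- by rewrite card_sum !card_ord cV.
- move=> e eD; have e3 := uniform3_card (edges_uniform3 _) eD.
  have [inU inR] := full (f @: e) (etrans (card_imset _ injf) e3).
  move: eD; rewrite /= inE => /orP[] /imsetP[t tE eq_e].
    apply: inU; rewrite eq_e -imset_comp; apply/subsetP => _ /imsetP[i _ ->].
    exact: enumU.
  apply: inR.
    move: tE; rewrite inE => /andP[_ /exists_inP[v vt /eqP v0]].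
    have -> : x = f (inr v) by rewrite /f v0.
    by apply: imset_f; rewrite eq_e; apply: imset_f.
  rewrite disjoint_subset eq_e -imset_comp; apply/subsetP => _ /imsetP[i _ ->].
  by rewrite inE /= sU.
by rewrite card_K6_star // cE.
Qed.

Theorem corollary1 (n : nat) (hn : 14 <= n) :
  ex3 n P33 C33 = 20 + 'C(n - 7, 2) /\
  (forall (V : finType) (hV : #|V| = n) (H : graph3 V),
     H \in Ex3 V P33 C33 <-> isomorphic H (dunion (K3 6) (S3 (n - 6)))).
Proof.
have n6 : n = 6 + (n - 6) by rewrite subnKC // (leq_trans _ hn).
have n7 : n - 7 = (n - 6).-1 by rewrite -subnS.
have m0 : 0 < n - 6 by rewrite subn_gt0 (leq_trans _ hn).
pose D := dunion (K3 6) (S3 (n - 6)).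
have cD : #|{: 'I_6 + 'I_(n - 6)}| = n by rewrite card_sum !card_ord -n6.
have upper (V : finType) (H : graph3 V) : #|V| = n -> free P33 H -> contains C33 H ->
    #|edges H| <= 20 + 'C(n - 7, 2) /\
    (#|edges H| = 20 + 'C(n - 7, 2) -> isomorphic H D).
  move=> cV /free_path pH /contains_triangle[x1 [x2 [x3 [y1 [y2 [y3 tH]]]]]].
  have V14 : 14 <= #|V| by rewrite cV.
  have [le extr] := triangle_extremal (edges_uniform3 H) pH V14 tH.
  rewrite cV in le extr; split=> // eqN.
  have [U [x [U6 xU full]]] := extr eqN.
  by apply: (extremal_isomorphic _ _ U6 xU full); rewrite ?cV // eqN n7.
have lower (V : finType) (H : graph3 V) : isomorphic H D ->
    [/\ free P33 H, contains C33 H & #|edges H| = 20 + 'C(n - 7, 2)].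
  move=> iso; split.
  - by apply: contra (K6_star_free (n - 6)); apply: isomorphic_contains.
  - exact: isomorphic_contains (isomorphic_sym iso) (K6_star_contains _).
  by rewrite (isomorphic_card iso) card_K6_star // n7.
have ex3E : ex3 n P33 C33 = 20 + 'C(n - 7, 2).
  apply/eqP; rewrite eqn_leq; apply/andP; split.
    apply/bigmax_leqP => H /andP[fH cH].
    by have [] := upper _ H (card_ord n) fH cH.
  have [H isoH] : exists H : graph3 'I_n, isomorphic D H.
    by apply: isomorphic_copy; rewrite cD card_ord.
  have [fH cH <-] := lower _ H (isomorphic_sym isoH).
  by apply: (leq_bigmax_cond (F := fun H : graph3 'I_n => #|edges H|)); rewrite fH cH.
split=> // V cV H; rewrite inE cV ex3E; split.
  by case/and3P=> fH cH /eqP eqN; apply: (upper V H cV fH cH).2.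
by move=> /lower[-> -> ->] /=.
Qed.
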